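(* Let $\mathbb{G}$ be a connected ribbon graph. There exists a (bigraded, free abelian) cochain complex $\widetilde{C}(\mathbb{G})$ whose generators are in one-to-one correspondence with the spanning quasi-trees of $\mathbb{G}$ and whose homology is $\widetilde{Kh}(\mathbb{G})$.
   Context: **Ribbon graphs.** A ribbon graph $\mathbb{G}$ (always oriented) is a finite nonempty graph (loops and multiple edges allowed) together with an embedding into a closed oriented surface $\Sigma$ whose complement is a disjoint union of open disks; equivalently, a graph with a cyclic order of the half-edges at each vertex. $\Sigma_{\mathbb{G}}$ is a regular neighborhood of $\mathbb{G}$ in $\Sigma$: one disk per vertex and one band per edge. $F(\mathbb{G})$ is the set of boundary components of $\Sigma_{\mathbb{G}}$. A spanning ribbon subgraph $\mathbb{H}$ has the same vertices, a subset of the edges, and inherited cyclic orders; it has its own surface $\Sigma_{\mathbb{H}}$ and set $F(\mathbb{H})$. A spanning quasi-tree of $\mathbb{G}$ is a spanning ribbon subgraph $\mathbb{T}$ such that $\Sigma_{\mathbb{T}}$ has exactly one boundary component. **Bigraded groups.** For a bigraded abelian group $M$ ($i$ homological, $j$ polynomial grading), $(M[r]\{s\})^{i,j}=M^{i-r,j-s}$. $V$ is free abelian on $v_+,v_-$ in bigradings $(0,1),(0,-1)$. Define $m:V\otimes V\to V$ by $v_+\otimes v_+\mapsto v_+$, $v_+\otimes v_-\mapsto v_-$, $v_-\otimes v_+\mapsto v_-$, $v_-\otimes v_-\mapsto 0$, and $\Delta:V\to V\otimes V$ by $v_+\mapsto v_+\otimes v_-+v_-\otimes v_+$, $v_-\mapsto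 v_-\otimes v_-$. **Khovanov homology of a ribbon graph.** Let $\mathbb{G}$ have edges $e_1,\dots,e_n$. For $I=(m_1,\dots,m_n)\in\{0,1\}^n$ let $h(I)=\sum m_i$, let $\mathbb{G}(I)$ be the spanning ribbon subgraph with edge set $\{e_i: m_i=1\}$, and $V(\mathbb{G}(I))=V^{\otimes F(\mathbb{G}(I))}[h(I)]\{h(I)\}$. $CKh(\mathbb{G})=\bigoplus_I V(\mathbb{G}(I))$. If $J$ is obtained from $I$ by changing the $k$th coordinate from $0$ to $1$ (a hypercube edge $\xi:I\to J$), adding the band of $e_k$ merges two boundary components or splits one into two; $d_\xi$ is $m$ (merge) or $\Delta$ (split) on the affected factors and the identity on the others. The differential is $d=\sum_\xi(-1)^{|\{i<k:\,m_i=1\}|}d_\xi$; it raises $i$ by 1 and preserves $j$. Reduced version: fix a marked point on the boundary of a vertex disk of $\Sigma_{\mathbb{G}}$ away from all bands; each $\Sigma_{\mathbb{G}(I)}$ has a unique boundary component containing it. $\widetilde{CKh}(\mathbb{G})$ is the subcomplex of $CKh(\mathbb{G})$ in which the factor of the marked component is $\mathbb{Z}v_-$, with polynomial grading shifted up by $1$; $\widetilde{Kh}(\mathbb{G})$ is its (bigraded) homology. *)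

(* Defs.v *)
From HB Require Import structures.
From mathcomp Require Import all_boot all_order all_fingroup all_algebra.
From mathcomp Require Import ring_quotient boolp.

Set Implicit Arguments.
Unset Strict Implicit.
Unset Printing Implicit Defensive.

Import GRing.Theory.
Local Open Scope ring_scope.

(* Finitely generated free abelian bigraded groups with a distinguished finite
   homogeneous basis, together with an endomorphism given by its matrix. *)

Record bgroup := BGroup {
  gen : finType;
  bideg : gen -> int * int; (* (homological, polynomial) *)
  coef : gen -> gen -> int  (* coef x y = coefficient of y in d x *)
}.

Notation chain C := {ffun gen C -> int}.

Definition bdiff (C : bgroup) (f : chain C) : chain C :=
  [ffun y => \sum_x f x * coef x y].

Definition homog (C : bgroup) (i j : int) (f : chain C) : bool :=
  [forall x, (f x != 0) ==> (bideg x == (i, j))].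

Definition is_cochain_complex (C : bgroup) : Prop :=
  (forall x y : gen C, coef x y != 0 ->
     bideg y = ((bideg x).1 + 1, (bideg x).2)) /\
  (forall f : chain C, bdiff (bdiff f) = 0).

Lemma bdiffB (C : bgroup) : {morph @bdiff C : f g / f - g}.
Proof.
move=> f g; apply/ffunP => y; rewrite !ffunE -sumrB.
by apply: eq_bigr => x _; rewrite !ffunE mulrBl.
Qed.

Lemma bdiff0 (C : bgroup) : @bdiff C 0 = 0.
Proof. by rewrite -[in LHS](subrr 0) bdiffB subrr. Qed.

Lemma homog0 (C : bgroup) i j : homog i j (0 : chain C).
Proof. by apply/forallP => x; rewrite ffunE eqxx. Qed.

Lemma homogB (C : bgroup) i j (f g : chain C) :
  homog i j f -> homog i j g -> homog i j (f - g).
Proof.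
move=> /forallP hf /forallP hg; apply/forallP => x; move: (hf x) (hg x).
rewrite !ffunE; have [->|_ /= ->] := eqVneq (f x) 0; last by rewrite !implybT.
by have [->|_ _ /= ->] := eqVneq (g x) 0; rewrite ?subr0 ?eqxx ?implybT.
Qed.

Definition cocycle_pred (C : bgroup) (i j : int) : pred (chain C) :=
  fun f => homog i j f && (bdiff f == 0).

Fact cocycle_closed (C : bgroup) i j : zmod_closed (@cocycle_pred C i j).
Proof.
split=> [|f g]; first by rewrite unfold_in /cocycle_pred homog0 bdiff0 eqxx.
rewrite !unfold_in /cocycle_pred => /andP[hf /eqP df] /andP[hg /eqP dg].
by rewrite homogB //= bdiffB df dg subrr.
Qed.

HB.instance Definition _ (C : bgroup) i j :=
  GRing.isZmodClosed.Build (chain C) (@cocycle_pred C i j)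
    (@cocycle_closed C i j).

Record cocycle (C : bgroup) (i j : int) := Cocycle {
  cocycle_val :> chain C;
  _ : cocycle_val \in @cocycle_pred C i j
}.

HB.instance Definition _ (C : bgroup) i j := [isSub for @cocycle_val C i j].
HB.instance Definition _ (C : bgroup) i j := [Choice of cocycle C i j by <:].
HB.instance Definition _ (C : bgroup) i j :=
  [SubChoice_isSubZmodule of cocycle C i j by <:].

(* The coboundaries that are cocycles: this is the subgroup of all coboundaries
   when C is a cochain complex. *)
Definition coboundary_pred (C : bgroup) (i j : int) : pred (cocycle C i j) :=
  fun z => `[< exists2 g : chain C,
                 homog (i - 1) j g & bdiff g = cocycle_val z >].

Fact coboundary_closed (C : bgroup) i j : zmod_closed (@coboundary_pred C i j).
Proof.
split=> [|y z]; first by apply/asboolP; exists 0; rewrite ?homog0 ?bdiff0.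
move=> /asboolP[f hf df] /asboolP[g hg dg]; apply/asboolP; exists (f - g).
  exact: homogB.
by rewrite bdiffB df dg.
Qed.

HB.instance Definition _ (C : bgroup) i j :=
  GRing.isZmodClosed.Build (cocycle C i j) (@coboundary_pred C i j)
    (@coboundary_closed C i j).

Definition homology (C : bgroup) (i j : int) : zmodType :=
  Quotient.quot
    (GRing.ZmodClosed.clone (cocycle C i j) (@coboundary_pred C i j) _).

Definition same_homology (C D : bgroup) : Prop :=
  forall i j : int,
    exists f : {additive homology C i j -> homology D i j}, bijective f.

(* The edges are 0, ..., n-1, and (e, b) for b : bool are the two half-edges of
   e.  The orbits of vrot are the cyclically ordered sets of half-edges around
   the vertices that carry at least one half-edge. *)

Record ribbon_graph := RibbonGraph {
  vertex : finType;
  nedges : nat;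
  hvert : 'I_nedges * bool -> vertex;
  vrot : {perm 'I_nedges * bool};
  hvert_vrot : forall h k, (hvert h == hvert k) = (k \in porbit vrot h);
  vertex_gt0 : (0 < #|vertex|)%N
}.

Notation edge G := 'I_(nedges G).
Notation hedge G := (edge G * bool)%type.

Definition flip (G : ribbon_graph) (h : hedge G) : hedge G := (h.1, ~~ h.2).

Definition adjacent (G : ribbon_graph) (u v : vertex G) : bool :=
  [exists h : hedge G, (hvert h == u) && (hvert (flip h) == v)].

Definition connected (G : ribbon_graph) : Prop :=
  forall u v : vertex G, connect (@adjacent G) u v.

Definition isolated (G : ribbon_graph) (v : vertex G) : bool :=
  [forall h : hedge G, hvert h != v].

(* Cutting the boundary circles of the vertex disks at the feet of all the bands
   of G leaves the arcs: inl h is the arc running from the foot of vrot^-1 h to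
   the foot of h, and inr v is the uncut circle of an isolated vertex v. *)

Definition bdarc (G : ribbon_graph) :=
  (hedge G + {v : vertex G | isolated v})%type.

HB.instance Definition _ G := Finite.on (bdarc G).

(* A spanning ribbon subgraph is given by its set A of edges.  Walking along the
   boundary of its surface, on reaching the foot of h one follows the band of h
   to its other foot if h belongs to A; otherwise there is no band at h and one
   stays on the circle. *)

Definition next_arc (G : ribbon_graph) (A : {set edge G}) (p : bdarc G) :
  bdarc G :=
  match p with
  | inl h => inl (vrot G (if h.1 \in A then flip h else h))
  | inr v => inr v
  end.

Lemma next_arc_inj (G : ribbon_graph) (A : {set edge G}) :
  injective (next_arc A).
Proof.
have flK : involutive (@flip G) by case=> e b; rewrite /flip /= negbK.
case=> [h|v] [k|w] //= [].
move=> /perm_inj hk; congr inl; move: hk.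
case: ifP => hA; case: ifP => kA hk.
- exact: (inv_inj flK).
- by move: hA kA; rewrite -hk /flip /= => ->.
- by move: hA kA; rewrite hk /flip /= => ->.
- exact: hk.
Qed.

Definition walk (G : ribbon_graph) (A : {set edge G}) : {perm bdarc G} :=
  perm (@next_arc_inj G A).

Fact mem_porbits (T : finType) (s : {perm T}) (x : T) :
  porbit s x \in porbits s.
Proof. exact: imset_f. Qed.

(* F(A), a boundary component being identified with the set of its arcs *)
Notation bcomp A := {c : {set bdarc _} | c \in porbits (walk A)}.

Definition bcomp_of (G : ribbon_graph) (A : {set edge G}) (p : bdarc G) :
  bcomp A := exist _ (porbit (walk A) p) (mem_porbits _ p).

Definition quasi_tree (G : ribbon_graph) :=
  {A : {set edge G} | #|{: bcomp A}| == 1%N}.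

(* Basis of V *)
Notation label := bool.
Definition vplus : label := true.
Definition vminus : label := false.

Definition label_deg (a : label) : int := if a then 1 else -1.

(* coefficient of c in m(a (x) b) *)
Definition m_coef (a b c : label) : int :=
  match a, b with
  | true, true => (c == vplus)%:R
  | true, false | false, true => (c == vminus)%:R
  | false, false => 0
  end.

(* coefficient of b (x) c in Delta(a) *)
Definition Delta_coef (a b c : label) : int :=
  match a with
  | true => ((b == vplus) && (c == vminus) || (b == vminus) && (c == vplus))%:R
  | false => ((b == vminus) && (c == vminus))%:R
  end.

(* The basis of CKh(G): pairs of an edge set A and a pure tensor of V^{(x) F(A)}
   in the v_+, v_-. *)
Notation state G := {A : {set edge G} & {ffun bcomp A -> label}}.

Definition state_bideg (G : ribbon_graph) (s : state G) : int * int :=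
  let: existT A x := s in
  (#|A|%:Z, \sum_(c : bcomp A) label_deg (x c) + #|A|%:Z).

(* Coefficient of y in d_xi(x), for the hypercube edge xi from A to B = A + e.
   The components of A at the two feet of e are merged if distinct, and split if
   equal; every other component of A is also a component of B. *)
Definition cube_coef (G : ribbon_graph) (A B : {set edge G}) (e : edge G)
    (x : {ffun bcomp A -> label}) (y : {ffun bcomp B -> label}) : int :=
  let h0 : bdarc G := inl (e, false) in
  let h1 : bdarc G := inl (e, true) in
  let same_elsewhere :=
    [forall p : bdarc G,
      (bcomp_of A p != bcomp_of A h0) && (bcomp_of A p != bcomp_of A h1) ==>
      (x (bcomp_of A p) == y (bcomp_of B p))] in
  if same_elsewhere then
    if bcomp_of A h0 != bcomp_of A h1
    then m_coef (x (bcomp_of A h0)) (x (bcomp_of A h1)) (y (bcomp_of B h0))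
    else Delta_coef (x (bcomp_of A h0)) (y (bcomp_of B h0)) (y (bcomp_of B h1))
  else 0.

(* The sum has at most one term. *)
Definition state_coef (G : ribbon_graph) (s t : state G) : int :=
  let: existT A x := s in
  let: existT B y := t in
  \sum_(e : edge G | (e \notin A) && (B == e |: A))
     (-1) ^+ #|[set i in A | (i < e)%N]| * cube_coef e x y.

Definition CKh (G : ribbon_graph) : bgroup :=
  BGroup (@state_bideg G) (@state_coef G).

(* A marked point on the boundary of a vertex disk, away from the bands, is
   given up to isotopy by the arc p that contains it. *)
Definition marked_minus (G : ribbon_graph) (p : bdarc G) (s : state G) : bool :=
  let: existT A x := s in x (bcomp_of A p) == vminus.

Notation rstate p := {s : state _ | marked_minus p s}.

(* These states span a subcomplex of CKh(G), since m maps v_- (x) V into Z v_-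
   and Delta maps v_- to v_- (x) v_-; hence restricting the matrix restricts the
   differential. *)
Definition rCKh (G : ribbon_graph) (p : bdarc G) : bgroup :=
  BGroup
    (fun s : rstate p =>
       ((state_bideg (val s)).1, (state_bideg (val s)).2 + 1))
    (fun s t : rstate p => state_coef (val s) (val t)).

(* Main.v *)
From HB Require Import structures.
Require Import Defs.
From mathcomp Require Import all_boot all_fingroup all_algebra.
From mathcomp Require Import generic_quotient ring_quotient boolp zify ring.

Set Implicit Arguments.
Unset Strict Implicit.
Unset Printing Implicit Defensive.

Import GRing.Theory.
Local Open Scope ring_scope.
Local Open Scope quotient_scope.

(** The reduced complex has one generator for each edge set A and each
    labelling of the boundary components of A that is v_- on the marked one.
    If the differential has an invertible block from a set of generators to a
    disjoint one, Gaussian elimination removes both sets without changing the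
    homology ([collapses_homology]).  So the point is to find such a block that
    leaves as many generators as there are quasi-trees.

    The block is built by recursion on the set D of edges that may still vary
    around a quasi-tree T.  If some edge e of D belongs to one quasi-tree of
    this range and not to another, the states whose edge set contains e span a
    subcomplex, and the blocks found for the two halves glue to a triangular,
    hence invertible, one ([collapses_union]).

    Otherwise T is the only quasi-tree of the range.  The edges of D are then
    chords of the single boundary circle of T, and no two of them interlace,
    since toggling two interlaced edges gives another quasi-tree
    ([toggle_splits]).  An innermost chord e ([innermost_edge]) cuts off an arc
    that carries no foot of the other edges of D.  Toggling e turns this arc
    into a circle S, which stays a boundary component whatever the other edges
    of D do.  If adding e merges S with another circle, multiplication by v_+
    is an isomorphism, and the states where S is labelled v_+ cancel against
    those that contain e.  If adding e splits S off, comultiplication followed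
    by the projection to v_- on S is an isomorphism, and the states without e
    cancel against those where S is labelled v_-.  In both cases there remain
    states in which S carries a fixed label, so S plays no further part and
    one edge has been used up ([collapses_peel]).  When D is empty there is a
    single state.

    Two facts complete the argument.  The square of the differential vanishes:
    the group of A is the quotient of the polynomial ring Z[x_q], q ranging
    over the arcs, by the relations x_q ^ 2 = 0, and x_q = x_r when q and r lie
    on the same component, with v_+ = 1 and v_- = x.  In these terms a merge is
    the quotient map and a split along e is multiplication by the sum of the
    variables of the two feet of e ([edge_coef_monom]), so the two ways around
    a square of the cube are multiplications by elements that can be compared
    ([edge_compC]).  And a connected ribbon graph has a quasi-tree: an edge set
    with the least number of boundary components is one, because no toggling
    may merge two components ([connected_one_boundary]). *)

(** * Maps induced on homology *)

Lemma pi_homologyB (C : bgroup) (i j : int) :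
  {morph \pi_(homology C i j) : y z / y - z}.
Proof. exact: pi_is_zmod_morphism. Qed.

Lemma pi_homology_surj (C : bgroup) (i j : int) (u : homology C i j) :
  exists z, u = \pi_(homology C i j) z.
Proof. by exists (repr u); rewrite reprK. Qed.

Section CochainMaps.

Variables (C D : bgroup) (F : chain C -> chain D).
Hypothesis FB : {morph F : f g / f - g}.
Hypothesis homogF : forall i j f, homog i j f -> homog i j (F f).
Hypothesis FbdiffE : forall f, F (bdiff f) = bdiff (F f).

Lemma cochain_map0 : F 0 = 0.
Proof. by rewrite -[in LHS](subrr 0) FB subrr. Qed.

Lemma cochain_map_cocycle i j (z : cocycle C i j) :
  F z \in @cocycle_pred D i j.
Proof.
case: z => f /= /andP[hf /eqP df]; apply/andP; split; first exact: homogF.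
by rewrite -FbdiffE df cochain_map0.
Qed.

Definition cocycle_map i j (z : cocycle C i j) : cocycle D i j :=
  Cocycle (cochain_map_cocycle z).

Lemma cocycle_mapB i j : {morph @cocycle_map i j : y z / y - z}.
Proof. by move=> y z; apply: val_inj => /=; rewrite FB. Qed.

Lemma cocycle_map_coboundary i j (z : cocycle C i j) :
  z \in @coboundary_pred C i j -> cocycle_map z \in @coboundary_pred D i j.
Proof.
rewrite !unfold_in /coboundary_pred => /asboolP[g hg dg]; apply/asboolP.
by exists (F g); [exact: homogF | rewrite -FbdiffE dg].
Qed.

Definition homology_map i j (u : homology C i j) : homology D i j :=
  \pi_(homology D i j) (cocycle_map (repr u)).

Lemma homology_map_pi i j (z : cocycle C i j) :
  homology_map (\pi_(homology C i j) z) = \pi_(homology D i j) (cocycle_map z).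
Proof.
apply/eqP; rewrite /homology_map -Quotient.idealrBE -cocycle_mapB.
by apply: cocycle_map_coboundary; rewrite Quotient.idealrBE reprK.
Qed.

Lemma homology_mapB i j : zmod_morphism (@homology_map i j).
Proof.
move=> u v; rewrite -[u]reprK -[v]reprK -pi_homologyB !homology_map_pi.
by rewrite cocycle_mapB pi_homologyB.
Qed.

End CochainMaps.

Lemma homotopy_same_homology (C D : bgroup)
    (F : chain C -> chain D) (H : chain D -> chain C) (h : chain D -> chain D) :
    {morph F : f g / f - g} -> {morph H : f g / f - g} ->
    (forall i j f, homog i j f -> homog i j (F f)) ->
    (forall i j f, homog i j f -> homog i j (H f)) ->
    (forall i j f, homog i j f -> homog (i - 1) j (h f)) ->
    (forall f, F (bdiff f) = bdiff (F f)) ->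
    (forall f, H (bdiff f) = bdiff (H f)) ->
    (forall f, H (F f) = f) ->
    (forall f, f - F (H f) = bdiff (h f) + h (bdiff f)) ->
    (h 0 = 0) ->
  same_homology C D.
Proof.
move=> FB HB homogF homogH homogh Fd Hd HF FH h0 i j.
pose Fh := homology_map FB homogF Fd (i := i) (j := j).
pose aF := GRing.isZmodMorphism.Build _ _ Fh (homology_mapB FB homogF Fd (i:=i) (j:=j)).
pose Fa : {additive homology C i j -> homology D i j} := HB.pack Fh aF.
exists Fa; exists (homology_map HB homogH Hd (i := i) (j := j)) => u.
  have -> : Fa u = Fh u by [].
  have [z ->] := pi_homology_surj u; rewrite /Fh !homology_map_pi.
  by congr (\pi_ _ _); apply: val_inj; rewrite /= HF.
have -> : Fa =1 Fh by [].
have [z ->] := pi_homology_surj u; rewrite /Fh !homology_map_pi.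
apply/esym/eqP; rewrite -Quotient.idealrBE unfold_in /coboundary_pred.
apply/asboolP; exists (h z) => /=; last first.
  by case: z => f /= /andP[_ /eqP df]; rewrite FH df h0 addr0.
by case: z => f /= /andP[hf _]; exact: homogh.
Qed.

(** * Invertible blocks of a differential *)

Lemma sum_neq0 (I : finType) (F : I -> int) :
  \sum_i F i != 0 -> exists i, F i != 0.
Proof.
move=> n0; apply/existsP; apply: contraNT n0; rewrite negb_exists => /forallP F0.
by apply/eqP/big1 => i _; apply/eqP/negbNE.
Qed.

Lemma big_val (T : finType) (P : pred T) (F : T -> int) :
    (forall x, ~~ P x -> F x = 0) ->
  \sum_(u : {x | P x}) F (val u) = \sum_x F x.
Proof.
move=> F0; rewrite [RHS](bigID P) /= [X in _ + X]big1 ?addr0; last first.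
  by move=> x /F0.
rewrite (reindex_omap (val : {x | P x} -> T) insub) /= => [|x Px]; last first.
  by rewrite insubT.
by apply: eq_bigl => u; rewrite valK eqxx (valP u).
Qed.

Section Collapse.

Variables (T : finType) (deg : T -> int * int) (d : T -> T -> int).

(** The bidegree of the differential: an incidence coefficient may be nonzero
    only between generators related in this way. *)
Definition raises (x y : T) : bool := deg y == ((deg x).1 + 1, (deg x).2).

(** [K] is the inverse matrix of the block of [d] from [A] to [B]. Its support
    is part of the definition, so that the sums may run over all generators. *)
Definition inverse_block (A B : {set T}) (K : T -> T -> int) : Prop :=
  [/\ forall b a, K b a != 0 -> [&& b \in B, a \in A & raises a b],
      forall a a', a \in A -> \sum_b d a b * K b a' = (a == a')%:R
    & forall b b', b' \in B -> \sum_a K b a * d a b' = (b == b')%:R].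

(** Here [X] is any piece of a based complex, [A] and [B] are the source and
    the target of an invertible block inside it, and [n] generators of [X] are
    left over. *)
Definition collapses (X : {set T}) (n : nat) : Prop :=
  exists A B : {set T}, exists K,
    [/\ A \subset X, B \subset X, [disjoint A & B], #|X| = (#|A| + #|B| + n)%N
      & inverse_block A B K].

Lemma collapses_all (X : {set T}) : collapses X #|X|.
Proof.
exists set0, set0, (fun _ _ => 0).
split; rewrite ?sub0set ?cards0 ?add0n //; first by rewrite -setI_eq0 setI0.
by split=> [b a|a a'|b b']; rewrite ?eqxx ?inE.
Qed.

(** A block in which every row and every column has exactly one nonzero entry,
    a unit, is invertible. *)
Lemma collapses_matching (A B : {set T}) (f g : T -> T) :
    [disjoint A & B] ->
    {in A, forall a, f a \in B} -> {in B, forall b, g b \in A} ->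
    {in A, cancel f g} -> {in B, cancel g f} ->
    {in A, forall a, d a (f a) ^+ 2 = 1} ->
    {in A & B, forall a b, d a b != 0 -> b = f a} ->
    {in A, forall a, raises a (f a)} ->
  collapses (A :|: B) 0.
Proof.
move=> AB fAB gBA fK gK d1 df rf.
pose K b a := if [&& b \in B, a \in A & b == f a] then d a b else 0.
exists A, B, K; rewrite subsetUl subsetUr addn0; split => //.
  by rewrite cardsU disjoint_setI0 // cards0 subn0.
split=> [b a|a a' aA|b b' bB]; rewrite /K.
- by case: ifP => [/and3P[-> aA /eqP ->] _|]; rewrite ?eqxx // aA rf.
- rewrite (bigD1 (f a)) //= big1 ?addr0 => [|b bfa]; last first.
    case: ifP => [/and3P[bB aA' _]|_]; last by rewrite mulr0.
    have [->|/df h] := eqVneq (d a b) 0; first by rewrite mul0r.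
    by rewrite h ?eqxx in bfa.
  rewrite fAB //=; have [<-|aa'] := eqVneq a a'.
    by rewrite aA eqxx /= -expr2 d1.
  case: ifP => [/andP[a'A /eqP faa']|_]; last by rewrite mulr0.
  by move: aa'; rewrite -[a]fK // faa' fK ?eqxx.
- rewrite (bigD1 (g b')) //= big1 ?addr0 => [|a agb].
    rewrite gBA ?gK //=; have [->|] := eqVneq b b'; last by rewrite andbF mul0r.
    by rewrite bB /= -expr2 -{2}[b']gK // d1 ?gBA.
  case: ifP => [/and3P[_ aA _]|_]; last by rewrite mul0r.
  have [->|/df h] := eqVneq (d a b') 0; first by rewrite mulr0.
  by move: agb; rewrite h // fK ?eqxx.
Qed.

(** The block of the union is triangular with diagonal blocks inverted by [K]
    and [K'], so its inverse is K + K' - K d K'. *)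
Lemma inverse_block_union (X Y A B A' B' : {set T}) K K' :
    [disjoint X & Y] -> {in Y & X, forall y x, d y x = 0} ->
    (forall x y, d x y != 0 -> raises x y) ->
    A \subset X -> B \subset X -> A' \subset Y -> B' \subset Y ->
    inverse_block A B K -> inverse_block A' B' K' ->
  exists L, inverse_block (A :|: A') (B :|: B') L.
Proof.
move=> XY dYX dr /subsetP AX /subsetP BX /subsetP AY /subsetP BY.
move=> [K1 K2 K3] [K1' K2' K3'].
pose KdK b a := \sum_x \sum_y K b x * d x y * K' y a.
have KdK_l b a : KdK b a = \sum_y (\sum_x K b x * d x y) * K' y a.
  rewrite /KdK exchange_big /=; apply: eq_bigr => y _; rewrite mulr_suml.
  by [].
have KdK_r b a : KdK b a = \sum_x K b x * (\sum_y d x y * K' y a).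
  by apply: eq_bigr => x _; rewrite mulr_sumr; apply: eq_bigr => y _; rewrite mulrA.
have dK_0 a a' : a \in A' -> \sum_b d a b * K b a' = 0.
  move=> aA; apply: big1 => b _; have [->|/K1/and3P[bB _ _]] := eqVneq (K b a') 0.
    by rewrite mulr0.
  by rewrite dYX ?mul0r ?AY ?BX.
have Kd_0 b b' : b' \in B -> \sum_a K' b a * d a b' = 0.
  move=> bB; apply: big1 => a _; have [->|/K1'/and3P[_ aA _]] := eqVneq (K' b a) 0.
    by rewrite mul0r.
  by rewrite dYX ?mulr0 ?AY ?BX.
exists (fun b a => K b a + K' b a - KdK b a); split.
- move=> b a; have [->|/K1/and3P[bB aA rab]] := eqVneq (K b a) 0; last first.
    by rewrite !inE bB aA rab.
  rewrite add0r; have [->|/K1'/and3P[bB aA rab]] := eqVneq (K' b a) 0; last first.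
    by rewrite !inE bB aA rab !orbT.
  rewrite add0r oppr_eq0 => /sum_neq0[x /sum_neq0[y]].
  rewrite !mulf_eq0 !negb_or => /andP[/andP[/K1/and3P[bB _ /eqP rb] /dr/eqP rxy]].
  case/K1'/and3P => [_ aA /eqP ra]; rewrite !inE bB aA orbT /=.
  rewrite /raises rb; move: ra; rewrite rxy => -[/addIr -> ->].
  by rewrite eqxx.
- move=> a a' aA; under eq_bigr do rewrite mulrBr mulrDr.
  rewrite sumrB big_split /=.
  have -> : \sum_b d a b * KdK b a' =
            \sum_x (\sum_b d a b * K b x) * (\sum_y d x y * K' y a').
    under eq_bigr do rewrite KdK_r mulr_sumr.
    rewrite exchange_big /=; apply: eq_bigr => x _.
    by rewrite mulr_suml; apply: eq_bigr => b _; rewrite mulrA.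
  case/setUP: aA => aA.
    rewrite K2 //; under [X in _ - X]eq_bigr do rewrite K2 //.
    rewrite [X in _ - X](bigD1 a) //= eqxx mul1r [X in _ - (_ + X)]big1.
      by rewrite addr0 addrK.
    by move=> x xa; rewrite eq_sym (negPf xa) mul0r.
  rewrite dK_0 // K2' // [X in _ - X]big1 ?subr0 ?add0r // => x _.
  by rewrite dK_0 // mul0r.
- move=> b b' bB; under eq_bigr do rewrite mulrBl mulrDl.
  rewrite sumrB big_split /=.
  have -> : \sum_a KdK b a * d a b' =
            \sum_y (\sum_x K b x * d x y) * (\sum_a K' y a * d a b').
    under eq_bigr do rewrite KdK_l mulr_suml.
    rewrite exchange_big /=; apply: eq_bigr => x _.
    by rewrite mulr_sumr; apply: eq_bigr => a _; rewrite mulrA.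
  case/setUP: bB => bB.
    rewrite K3 // Kd_0 // [X in _ - X]big1 ?subr0 ?addr0 // => y _.
    by rewrite Kd_0 // mulr0.
  rewrite K3' //; under [X in _ - X]eq_bigr do rewrite K3' //.
  rewrite [X in _ - X](bigD1 b') //= eqxx mulr1 [X in _ - (_ + X)]big1 => [|y yb].
    by rewrite addr0 addrC addrK.
  by rewrite (negPf yb) mulr0.
Qed.

(** With [X] the part of the cube without an edge and [Y] the part with it,
    [d] has no component from [Y] to [X]. *)
Lemma collapses_union (X Y : {set T}) (m n : nat) :
    [disjoint X & Y] -> {in Y & X, forall y x, d y x = 0} ->
    (forall x y, d x y != 0 -> raises x y) ->
  collapses X m -> collapses Y n -> collapses (X :|: Y) (m + n).
Proof.
move=> XY dYX dr [A [B [K [AX BX AB cX IK]]]] [A' [B' [K' [AY BY AB' cY IK']]]].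
have [L IL] := inverse_block_union XY dYX dr AX BX AY BY IK IK'.
exists (A :|: A'), (B :|: B'), L.
have sub (U V : {set T}) : U \subset X -> V \subset Y -> [disjoint U & V].
  by move=> UX VY; apply: (disjointWl UX); apply: (disjointWr VY).
have cU (U V : {set T}) : U \subset X -> V \subset Y -> #|U :|: V| = (#|U| + #|V|)%N.
  by move=> UX VY; rewrite cardsU disjoint_setI0 ?sub // cards0 subn0.
split; rewrite ?setUSS //; last by rewrite !cU //; lia.
rewrite -setI_eq0 setIUl !setIUr [A' :&: B]setIC.
rewrite (disjoint_setI0 AB) (disjoint_setI0 AB') (disjoint_setI0 (sub _ _ AX BY)).
by rewrite (disjoint_setI0 (sub _ _ BX AY)) !setU0 eqxx.
Qed.

End Collapse.

(** The reduced complex is carried by a subtype of the states, while the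
    recursion takes place among the subsets of the full set of states. *)
Lemma collapses_sub (T : finType) (P : pred T) (deg : T -> int * int)
    (deg' : {x | P x} -> int * int) (d : T -> T -> int) (n : nat) :
    (forall u v, raises deg (val u) (val v) = raises deg' u v) ->
  collapses deg d [set x | P x] n ->
  collapses deg' (fun u v => d (val u) (val v)) [set: {x | P x}] n.
Proof.
move=> degE [A [B [K [/subsetP AX /subsetP BX AB cX [K1 K2 K3]]]]].
have cV (Y : {set T}) : {subset Y <= [set x | P x]} ->
    #|[set u : {x | P x} | val u \in Y]| = #|Y|.
  move=> YX; rewrite -(card_imset _ val_inj); congr #|pred_of_set _|.
  apply/setP => x; apply/imsetP/idP => [[u + ->]|xY]; first by rewrite inE.
  have := YX x xY; rewrite inE => Px.
  by exists (exist _ x Px); rewrite ?inE.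
exists [set u | val u \in A], [set u | val u \in B], (fun u v => K (val u) (val v)).
split; rewrite ?subsetT //.
- rewrite -setI_eq0; apply/eqP/setP => u; rewrite !inE.
  by have [uA|//] := boolP (val u \in A); rewrite (disjointFr AB).
- rewrite !cV // -cX -(cV [set x | P x]) //.
  by apply: eq_card => u; rewrite !inE (valP u).
split=> [b a /K1|a a'|b b']; rewrite ?inE ?degE //.
  move=> /(K2 _ (val a')) aE; rewrite -(inj_eq val_inj) -aE -(big_val (P := P)) //.
  move=> x nPx; have [->|/K1/and3P[/BX]] := eqVneq (K x (val a')) 0.
    by rewrite mulr0.
  by rewrite inE (negPf nPx).
move=> /(K3 (val b)) bE; rewrite -(inj_eq val_inj) -bE -(big_val (P := P)) //.
move=> x nPx; have [->|/K1/and3P[_ /AX]] := eqVneq (K (val b) x) 0.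
  by rewrite mul0r.
by rewrite inE (negPf nPx).
Qed.

(** * Gaussian elimination *)

Section Reduction.

Variables (C : bgroup) (A B : {set gen C}) (K : gen C -> gen C -> int).
Hypothesis complexC : is_cochain_complex C.
Hypothesis disjAB : [disjoint A & B].
Hypothesis invK : inverse_block (@bideg C) (@coef C) A B K.

Local Notation d := (@bdiff C).
Implicit Types (f : chain C).

(** The contraction of the cancelled pairs: a homotopy h with h^2 = 0 and h d
    h = h, so that d h + h d is the projector that the elimination removes. *)
Definition hty (f : chain C) : chain C := [ffun a => \sum_b f b * K b a].

Lemma htyB : {morph hty : f g / f - g}.
Proof.
move=> f g; apply/ffunP => y; rewrite !ffunE -sumrB.
by apply: eq_bigr => x _; rewrite !ffunE mulrBl.
Qed.

Lemma hty0 : hty 0 = 0.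
Proof. by rewrite -[in LHS](subrr 0) htyB subrr. Qed.

Lemma bdiffK f : d (d f) = 0.
Proof. by case: complexC => _; apply. Qed.

Lemma hty_support f x : x \notin A -> hty f x = 0.
Proof.
move=> xA; rewrite ffunE big1 // => b _; apply/eqP; rewrite mulf_eq0.
by apply/orP; right; apply: contraR xA; case: invK => H _ _ /H/and3P[].
Qed.

Lemma hty_vanish f : {in B, forall b, f b = 0} -> hty f = 0.
Proof.
move=> f0; apply/ffunP => a; rewrite !ffunE big1 // => b _.
have [bB|] := boolP (b \in B); first by rewrite f0 ?mul0r.
move=> bB; apply/eqP; rewrite mulf_eq0; apply/orP; right.
by apply: contraR bB; case: invK => H _ _ /H/and3P[].
Qed.

(** [hty] inverts the block of [d] that leaves [A]. *)
Lemma htyK f : (forall x, x \notin A -> f x = 0) -> hty (d f) = f.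
Proof.
move=> f0; apply/ffunP => a; rewrite ffunE.
under eq_bigr do rewrite ffunE mulr_suml.
rewrite exchange_big /= (bigD1 a) //= [X in _ + X]big1 ?addr0 => [|x xa].
  have [aA|/f0->] := boolP (a \in A); last by rewrite big1 // => b _; rewrite !mul0r.
  under eq_bigr do rewrite -mulrA; rewrite -mulr_sumr.
  by case: invK => _ -> // _; rewrite eqxx mulr1.
have [xA|/f0->] := boolP (x \in A); last by rewrite big1 // => b _; rewrite !mul0r.
under eq_bigr do rewrite -mulrA; rewrite -mulr_sumr.
by case: invK => _ -> // _; rewrite (negPf xa) mulr0.
Qed.

Lemma bdiff_hty f : {in B, forall b, d (hty f) b = f b}.
Proof.
move=> b bB; rewrite ffunE; under eq_bigr do rewrite ffunE mulr_suml.
rewrite exchange_big /= (bigD1 b) //= [X in _ + X]big1 ?addr0 => [|x xb].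
  under eq_bigr do rewrite -mulrA; rewrite -mulr_sumr.
  by case: invK => _ _ -> //; rewrite eqxx mulr1.
under eq_bigr do rewrite -mulrA; rewrite -mulr_sumr.
by case: invK => _ _ -> //; rewrite (negPf xb) mulr0.
Qed.

Lemma hty_hty f : hty (hty f) = 0.
Proof.
apply: hty_vanish => b bB; apply: hty_support; apply: contraL bB => bA.
by rewrite (disjointFr disjAB).
Qed.

Definition critical : finType := {x : gen C | x \notin A :|: B}.

(** The Schur complement: in a zig-zag each passage through the cancelled
    block contributes the inverse block with a minus sign. *)
Definition reduced_coef (x y : gen C) : int :=
  coef x y - \sum_a (\sum_b coef x b * K b a) * coef a y.

Definition reduced : bgroup :=
  @BGroup critical (fun u => bideg (val u))
    (fun u v => reduced_coef (val u) (val v)).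

Definition ext (g : chain reduced) : chain C :=
  [ffun x => oapp g 0 (insub x : option critical)].

Definition restr (f : chain C) : chain reduced := [ffun u => f (val u)].

Lemma restrB : {morph restr : f g / f - g}.
Proof. by move=> f f'; apply/ffunP => u; rewrite !ffunE. Qed.

Lemma extB : {morph ext : f g / f - g}.
Proof.
move=> f g; apply/ffunP => x; rewrite !ffunE.
by case: insub => [u|] /=; rewrite ?ffunE ?subr0.
Qed.

Lemma extK g : restr (ext g) = g.
Proof. by apply/ffunP => u; rewrite !ffunE valK. Qed.

Lemma ext_restr f x : ext (restr f) x = if x \notin A :|: B then f x else 0.
Proof.
by rewrite ffunE; case: insubP => [u -> <-|/negPf->] /=; rewrite ?ffunE.
Qed.

Lemma ext_vanish g x : x \in A :|: B -> ext g x = 0.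
Proof.
by move=> xAB; rewrite ffunE; case: insubP => [u|] //=; rewrite xAB.
Qed.

Lemma restr_hty f : restr (hty f) = 0.
Proof.
apply/ffunP => u; rewrite ffunE hty_support ?ffunE //.
by have := valP u; rewrite inE negb_or => /andP[].
Qed.

Lemma hty_ext g : hty (ext g) = 0.
Proof. by apply: hty_vanish => b bB; rewrite ext_vanish // inE bB orbT. Qed.

(** [ext (restr f)] differs from [f] by a chain supported on [A], on which the
    projector 1 - h d vanishes. *)
Lemma hty_bdiff_ext_restr f : {in B, forall b, f b = 0} ->
  ext (restr f) - hty (d (ext (restr f))) = f - hty (d f).
Proof.
move=> f0; set e := ext _.
have : hty (d (f - e)) = f - e.
  apply: htyK => x xA; rewrite ffunE [X in _ + X]ffunE ext_restr inE (negPf xA) /=.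
  by case: ifP => [_|/negbFE xB]; rewrite ?subrr // f0 // subr0.
rewrite bdiffB htyB => hp.
have -> : hty (d f) = f - e + hty (d e) by rewrite -hp subrK.
by rewrite opprD addrA subKr.
Qed.

Lemma bdiff_reduced g : bdiff g = restr (d (ext g) - d (hty (d (ext g)))).
Proof.
have sum_ext (F : gen C -> int) : \sum_x ext g x * F x = \sum_u g u * F (val u).
  rewrite -(big_val (P := fun x => x \notin A :|: B)) => [|x /negbNE xAB].
    by apply: eq_bigr => u _; rewrite ffunE valK.
  by rewrite ext_vanish ?mul0r.
apply/ffunP => v; rewrite [RHS]ffunE [RHS]ffunE [X in _ + X]ffunE.
have -> : bdiff g v = \sum_x ext g x * reduced_coef x (val v).
  by rewrite sum_ext ffunE.
under eq_bigr do rewrite mulrBr; rewrite sumrB; congr (_ - _); first by rewrite ffunE.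
rewrite ffunE; under [RHS]eq_bigr do rewrite ffunE.
transitivity (\sum_a \sum_x ext g x * ((\sum_b coef x b * K b a) * coef a (val v))).
  by rewrite exchange_big; apply: eq_bigr => x _; rewrite mulr_sumr.
apply: eq_bigr => a _; under eq_bigr do rewrite mulrA; rewrite -mulr_suml.
congr (_ * _); under [RHS]eq_bigr do rewrite ffunE mulr_suml.
rewrite exchange_big; apply: eq_bigr => x _; rewrite mulr_sumr.
by apply: eq_bigr => b _; rewrite mulrA.
Qed.

(** The projectors 1 - d h and 1 - h d, precomposed or postcomposed with the
    passage to the critical generators, are the two homotopy equivalences. *)
Definition proj (f : chain C) : chain reduced := restr (f - d (hty f)).
Definition incl (g : chain reduced) : chain C := ext g - hty (d (ext g)).

Lemma bdiff_incl g : incl (bdiff g) = d (incl g).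
Proof.
rewrite /incl [in RHS]bdiffB bdiff_reduced hty_bdiff_ext_restr.
  by rewrite bdiffB !bdiffK subrr hty0 subr0.
by move=> b bB; rewrite ffunE [X in _ + X]ffunE bdiff_hty ?subrr.
Qed.

Lemma bdiff_proj f : proj (d f) = bdiff (proj f).
Proof.
set k := f - d (hty f).
have k0 : {in B, forall b, k b = 0}.
  by move=> b bB; rewrite ffunE [X in _ + X]ffunE bdiff_hty ?subrr.
rewrite bdiff_reduced -bdiffB /proj -/k hty_bdiff_ext_restr //.
by rewrite bdiffB /k bdiffB bdiffK subr0.
Qed.

Lemma inclK g : proj (incl g) = g.
Proof.
rewrite /proj /incl htyB hty_hty subr0 hty_ext bdiff0 subr0.
by rewrite restrB restr_hty subr0 extK.
Qed.

Lemma incl_proj f : f - incl (proj f) = d (hty f) + hty (d f).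
Proof.
rewrite /incl /proj hty_bdiff_ext_restr => [|b bB]; last first.
  by rewrite ffunE [X in _ + X]ffunE bdiff_hty ?subrr.
by rewrite bdiffB bdiffK subr0 !opprB addrC -addrA subrK addrC.
Qed.

Lemma reduced_raises x y : reduced_coef x y != 0 -> raises (@bideg C) x y.
Proof.
case: complexC => dr _; case: invK => Kr _ _.
have [c0|/dr/eqP//] := eqVneq (coef x y) 0; rewrite /reduced_coef c0 sub0r oppr_eq0.
move=> /sum_neq0[a]; rewrite mulr_suml => /sum_neq0[b].
rewrite !mulf_eq0 !negb_or => /andP[/andP[/dr xb /Kr/and3P[_ _ /eqP ab]] /dr ya].
by move: ab; rewrite /raises ya xb => -[/addIr -> ->].
Qed.

(** The square of the reduced differential vanishes because [proj] is a
    surjective map commuting with the differentials, with section [incl]. *)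
Lemma reduced_complex : is_cochain_complex reduced.
Proof.
split=> [u v /reduced_raises/eqP//|g].
by rewrite -[g]inclK -!bdiff_proj bdiffK /proj hty0 bdiff0 subrr;
   apply/ffunP => u; rewrite !ffunE.
Qed.

Lemma homog_bdiff i j f : homog i j f -> homog (i + 1) j (d f).
Proof.
move=> /forallP hf; apply/forallP => y; apply/implyP; rewrite ffunE => /sum_neq0[x].
rewrite mulf_eq0 negb_or => /andP[fx /(proj1 complexC) ->].
by have /implyP/(_ fx)/eqP -> := hf x.
Qed.

Lemma homog_hty i j f : homog i j f -> homog (i - 1) j (hty f).
Proof.
move=> /forallP hf; apply/forallP => a; apply/implyP; rewrite ffunE => /sum_neq0[b].
rewrite mulf_eq0 negb_or => /andP[fb]; case: invK => Kr _ _ /Kr/and3P[_ _].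
have /implyP/(_ fb)/eqP := hf b; rewrite /raises => -> /eqP[-> ->].
by rewrite addrK; case: (bideg a).
Qed.

Lemma homog_restr i j f : homog i j f -> homog i j (restr f).
Proof. by move=> /forallP hf; apply/forallP => u; rewrite ffunE. Qed.

Lemma homog_ext i j g : homog i j g -> homog i j (ext g).
Proof.
move=> /forallP hg; apply/forallP => x; rewrite ffunE.
by case: insubP => [u _ <-|_] /=; rewrite ?eqxx.
Qed.

Lemma reduced_same_homology : same_homology reduced C.
Proof.
apply: (@homotopy_same_homology _ _ incl proj hty).
- by move=> f g; rewrite /incl extB bdiffB htyB !opprD addrACA.
- by move=> f g; rewrite /proj -restrB htyB bdiffB !opprD addrACA.
- move=> i j f hf; apply: homogB; first exact: homog_ext.
  by rewrite -[i](addrK 1); apply/homog_hty/homog_bdiff/homog_ext.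
- move=> i j f hf; apply/homog_restr/homogB => //.
  by rewrite -[i](subrK 1); apply/homog_bdiff/homog_hty.
- exact: homog_hty.
- exact: bdiff_incl.
- exact: bdiff_proj.
- exact: inclK.
- exact: incl_proj.
- exact: hty0.
Qed.

End Reduction.

Lemma collapses_homology (C : bgroup) (n : nat) : is_cochain_complex C ->
    collapses (@bideg C) (@coef C) [set: gen C] n ->
  exists D : bgroup,
    [/\ is_cochain_complex D, #|gen D| = n & same_homology D C].
Proof.
move=> complexC [A [B [K [_ _ AB cT invK]]]].
exists (reduced A B K); split.
- exact: reduced_complex.
- rewrite card_sig; have := cardsC (A :|: B); rewrite -cardsT cT.
  rewrite cardsU disjoint_setI0 // cards0 subn0 => /addnI <-.
  by apply: eq_card => x; rewrite !inE.
- exact: reduced_same_homology.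
Qed.

(** * Orbits of a permutation composed with a transposition *)

Section PermOrbits.

Variable T : finType.
Implicit Types (s t : {perm T}) (x y q : T).

Lemma eq_in_porbit s t (U : {pred T}) :
    {in U, forall q, s q \in U} -> {in U, s =1 t} ->
  {in U, porbit s =1 porbit t}.
Proof.
move=> sU st q qU.
have it i : ((s ^+ i) q \in U)%g && ((s ^+ i) q == (t ^+ i) q)%g.
  elim: i => [|i /andP[iU /eqP IH]]; first by rewrite !expg0 !perm1 qU eqxx.
  by rewrite !expgSr !permM -IH -(st _ iU) eqxx sU.
apply/setP => r; apply/porbitP/porbitP => -[i ->]; exists i;
  by case/andP: (it i) => _ /eqP.
Qed.

Lemma porbit_tperm_off s x y q :
    porbit s q != porbit s x -> porbit s q != porbit s y ->
  porbit (tperm x y * s)%g q = porbit s q.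
Proof.
rewrite !eq_porbit_mem => qx qy; apply/esym.
apply: (@eq_in_porbit _ _ (porbit s q)); last exact: porbit_id.
  move=> r /=; rewrite -!eq_porbit_mem => /eqP <-.
  by rewrite eq_porbit_mem (mem_porbit s 1 r).
move=> r rq; rewrite permM tpermD //.
  by apply: contraNneq qx => ->; rewrite porbit_sym.
by apply: contraNneq qy => ->; rewrite porbit_sym.
Qed.

(** The number of orbits of s and of the product changes by exactly one, in
    the direction given by whether x and y share an orbit; applying this count
    to both permutations excludes the other two possibilities. *)
Lemma porbit_tperm_eq s x y : x != y ->
  (porbit (tperm x y * s)%g x == porbit (tperm x y * s)%g y)
    = (porbit s x != porbit s y).
Proof.
move=> xy; have := porbits_mul_tperm s x y.
have := porbits_mul_tperm (tperm x y * s)%g x y.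
by rewrite /= tpermKg !eq_porbit_mem xy; do 2!case: (x \in _) => //=; lia.
Qed.

End PermOrbits.

(** * Boundary components under the toggling of an edge *)

Section BoundaryComponents.

Variable G : ribbon_graph.
Implicit Types (A B : {set edge G}) (e f : edge G) (p q r : bdarc G).

Definition same A p q : bool := porbit (walk A) p == porbit (walk A) q.

Definition foot e (b : bool) : bdarc G := inl (e, b).

(** Adding and removing an edge are both composition of the boundary walk with
    the same transposition, so both are handled as one involution. *)
Definition toggle e A : {set edge G} := if e \in A then A :\ e else e |: A.

Definition near A e q : bool := same A q (foot e false) || same A q (foot e true).

Lemma same_mem A q r : same A q r = (r \in porbit (walk A) q).
Proof. by rewrite /same eq_porbit_mem porbit_sym. Qed.

Lemma same_refl A q : same A q q. Proof. exact: eqxx. Qed.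

Lemma same_sym A q r : same A q r = same A r q. Proof. exact: eq_sym. Qed.

Lemma same_trans A r q p : same A q r -> same A r p -> same A q p.
Proof. by move=> /eqP qr /eqP rp; apply/eqP; rewrite qr. Qed.

Lemma same_l A q r : same A q r -> same A q =1 same A r.
Proof. by move=> /eqP qr p; rewrite /same qr. Qed.

Lemma same_r A q r : same A q r -> same A^~ q =1 same A^~ r.
Proof. by move=> /eqP qr p; rewrite /same qr. Qed.

Lemma same_walk A q : same A (walk A q) q.
Proof. by rewrite /same -[walk A q]/((walk A ^+ 1)%g q) porbit_perm. Qed.

Lemma in_toggle e A f : (f \in toggle e A) = (f == e) (+) (f \in A).
Proof.
rewrite /toggle; case: ifP => eA; rewrite !inE;
by have [->|] := eqVneq f e; rewrite ?eA.
Qed.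

Lemma toggleK e : involutive (toggle e).
Proof. by move=> A; apply/setP => f; rewrite !in_toggle addKb. Qed.

Lemma toggleC e f A : toggle e (toggle f A) = toggle f (toggle e A).
Proof. by apply/setP => g; rewrite !in_toggle addbCA. Qed.

Lemma toggleU e A : e \notin A -> toggle e A = e |: A.
Proof. by rewrite /toggle => /negPf->. Qed.

(** This is where orientability enters: the two feet of a band are exchanged
    without reversing the direction of the walk. *)
Lemma walk_toggle e A :
  walk (toggle e A) = (tperm (foot e false) (foot e true) * walk A)%g.
Proof.
apply/permP => q; rewrite permM [LHS]permE [RHS]permE.
case: q => [[f b]|v]; last by rewrite tpermD.
have [->|fe] := eqVneq f e; last first.
  have ne c : foot e c != inl (f, b) by apply: contraNneq fe => -[->].
  by rewrite tpermD // /= in_toggle (negPf fe).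
have -> : tperm (foot e false) (foot e true) (inl (e, b)) = foot e (~~ b).
  by case: b; rewrite ?tpermL ?tpermR.
by rewrite /= in_toggle eqxx; case: (e \in A); rewrite /flip /= ?negbK.
Qed.

Lemma walk_eq A B h : (h.1 \in A) = (h.1 \in B) -> walk A (inl h) = walk B (inl h).
Proof. by rewrite !permE /= => ->. Qed.

Lemma porbit_toggle_off A e q : ~~ near A e q ->
  porbit (walk (toggle e A)) q = porbit (walk A) q.
Proof. by rewrite negb_or walk_toggle => /andP[]; apply: porbit_tperm_off. Qed.

Lemma near_ex A e q : near A e q -> exists c, same A q (foot e c).
Proof. by case/orP => h; [exists false | exists true]. Qed.

Lemma near_foot A e b : near A e (foot e b).
Proof. by rewrite /near; case: b; rewrite same_refl ?orbT. Qed.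

Lemma near_same A e q r : same A q r -> near A e q = near A e r.
Proof. by move=> qr; rewrite /near !(same_l qr). Qed.

(** Toggling [e] redistributes the arcs of the components that meet the feet
    of [e] only among themselves. *)
Lemma near_toggle A e q : near (toggle e A) e q = near A e q.
Proof.
have sub B : near B e q -> near (toggle e B) e q.
  apply: contraLR => off; have oeq := porbit_toggle_off off.
  rewrite toggleK in oeq; apply: contra off.
  by rewrite /near !same_mem oeq.
by apply/idP/idP => [/sub|/sub //]; rewrite toggleK.
Qed.

(** Toggling [e] then splits a component in two; otherwise it merges two
    components. *)
Definition splits A e : bool := same A (foot e false) (foot e true).

Lemma splits_toggle A e : splits (toggle e A) e = ~~ splits A e.
Proof.
by rewrite /splits /same walk_toggle porbit_tperm_eq //; apply/eqP => -[].
Qed.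

Lemma same_toggle_off A e q r : ~~ near A e q ->
  same (toggle e A) q r = same A q r.
Proof. by move=> /porbit_toggle_off oeq; rewrite !same_mem oeq. Qed.

Lemma near_merged A e q b : ~~ splits A e -> near A e q ->
  same (toggle e A) q (foot e b).
Proof.
rewrite -splits_toggle -near_toggle /splits => s01.
by case: b; case/orP => // /same_trans; apply; rewrite // same_sym.
Qed.

(** A merge identifies the two components at the feet of [e] and nothing else.
    As toggling is an involution, this also describes splits, read backwards.
    *)
Lemma same_merge A e q r : ~~ splits A e ->
  same (toggle e A) q r = same A q r || near A e q && near A e r.
Proof.
move=> sA; have [nq|nq] := boolP (near A e q); last first.
  by rewrite same_toggle_off // orbF.
have [nr|nr] := boolP (near A e r); last first.
  by rewrite same_sym same_toggle_off // same_sym orbF.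
rewrite orbT; apply: same_trans (near_merged false sA nq) _.
by rewrite same_sym near_merged.
Qed.

Lemma card_porbits_toggle A e :
  (#|porbits (walk (toggle e A))| + (~~ splits A e).*2
    = #|porbits (walk A)|.+1)%N.
Proof.
have := porbits_mul_tperm (walk A) (foot e false) (foot e true).
rewrite /= -walk_toggle /splits same_sym same_mem -eq_porbit_mem => ->.
by rewrite -[RHS]addn1; congr (_ + _)%N; apply/eqP; rewrite eqb1; apply/eqP => -[].
Qed.

End BoundaryComponents.

(** * States and monomials *)

Section States.

Variable G : ribbon_graph.
Implicit Types (A B : {set edge G}) (e f : edge G) (p q r : bdarc G).
Implicit Types (s t u : state G) (l : bdarc G -> label) (S : seq (bdarc G)).

Definition edge_set s : {set edge G} := tag s.

(** A labelling of components is handled as a function on arcs that is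
    constant on components: this makes labellings of different edge sets
    comparable. *)
Definition lab s q : label := tagged s (bcomp_of (tag s) q).

Definition invariant_lab A l : Prop := forall q r, same A q r -> l q = l r.

Definition mk_state A l : state G :=
  existT _ A
    [ffun c => if [pick q | bcomp_of A q == c] is Some q then l q else false].

Lemma bcomp_of_eq A q r : (bcomp_of A q == bcomp_of A r) = same A q r.
Proof. by []. Qed.

Lemma bcomp_of_surj A (c : bcomp A) : exists q, c = bcomp_of A q.
Proof.
case: c => c cA; have /imsetP[q _ cE] := cA.
by exists q; apply: val_inj.
Qed.

Lemma lab_invariant s : invariant_lab (edge_set s) (lab s).
Proof. by move=> q r; rewrite -bcomp_of_eq /lab => /eqP ->. Qed.

Lemma state_ext s t : edge_set s = edge_set t -> lab s =1 lab t -> s = t.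
Proof.
case: s t => [A x] [B y]; rewrite /edge_set /lab /= => AB; case: B / AB y => y xy.
congr existT; apply/ffunP => c; have [q ->] := bcomp_of_surj c; exact: xy.
Qed.

Lemma lab_mk A l : invariant_lab A l -> lab (mk_state A l) =1 l.
Proof.
move=> lA q; rewrite /lab /= ffunE.
by case: pickP => [r|/(_ q)]; rewrite bcomp_of_eq ?same_refl // => /lA.
Qed.

Definition elab_coef e A l l' : int :=
  if [forall q, ~~ near A e q ==> (l q == l' q)] then
    if splits A e then
      Delta_coef (l (foot e false)) (l' (foot e false)) (l' (foot e true))
    else m_coef (l (foot e false)) (l (foot e true)) (l' (foot e false))
  else 0.

Definition edge_coef e s t : int :=
  if (e \notin edge_set s) && (edge_set t == e |: edge_set s) then
    elab_coef e (edge_set s) (lab s) (lab t)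
  else 0.

Definition edge_sign e A : int := (-1) ^+ #|[set i in A | (i < e)%N]|.

Lemma state_coefE s t :
  state_coef s t = \sum_e edge_sign e (edge_set s) * edge_coef e s t.
Proof.
case: s t => [A x] [B y]; rewrite /= big_mkcond; apply: eq_bigr => e _.
rewrite /edge_coef /edge_set /=; case: ifP => _; last by rewrite mulr0.
congr (_ * _); rewrite /cube_coef /elab_coef /lab /splits /= !bcomp_of_eq if_neg.
congr (if _ then _ else _); apply: eq_forallb => q.
by rewrite !bcomp_of_eq /near negb_or.
Qed.

(** The sequences of arcs for which the product of the variables x_q is
    nonzero: a repeated component gives a factor x ^ 2 = 0. *)
Definition indep A S : bool := pairwise (fun q r => ~~ same A q r) S.

Lemma indepP A S :
  reflect (uniq S /\ {in S &, forall q r, same A q r -> q = r}) (indep A S).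
Proof.
elim: S => [|q S IH] /=; first by apply: ReflectT.
apply: (iffP andP) => [[/allP qS /IH[uS inj]]|[/andP[qS uS] inj]].
  split=> [|r r']; first by rewrite uS andbT; apply/negP => /qS; rewrite same_refl.
  rewrite !inE => /predU1P[->|rS] /predU1P[->|r'S] //; last exact: inj.
    by move/negP: (qS _ r'S).
  by move/negP: (qS _ rS); rewrite same_sym.
split.
  apply/allP => r rS; apply: contra qS => qr.
  by rewrite (inj q r) ?mem_head // inE rS orbT.
by apply/IH; split=> // r r' rS r'S; apply: inj; rewrite inE ?rS ?r'S orbT.
Qed.

(** The label v_- (that is, false) on the components that meet [S]. *)
Definition minus_at A S q : label := ~~ has (same A q) S.

Lemma minus_at_invariant A S : invariant_lab A (minus_at A S).
Proof.
move=> q r qr; congr (~~ _); apply: eq_has; exact: same_l.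
Qed.

(** The product of the variables x_q for q in [S], as an element of the group
    of [A]: zero if two arcs share a component, and otherwise the basis state
    with v_- exactly on the components of [S]. *)
Definition monom A S s : int :=
  [&& edge_set s == A, indep A S & [forall q, lab s q == minus_at A S q]]%:R.

Lemma monom_indep A S s : indep A S ->
  monom A S s = (s == mk_state A (minus_at A S))%:R.
Proof.
move=> fS; rewrite /monom fS /=; congr (nat_of_bool _)%:R.
apply/andP/eqP => [[/eqP sA /forallP ls]|->].
  apply: state_ext => // q; rewrite lab_mk; last exact: minus_at_invariant.
  exact/eqP.
split; first by rewrite /edge_set.
by apply/forallP => q; rewrite lab_mk //; exact: minus_at_invariant.
Qed.

Lemma monom_dep A S s : ~~ indep A S -> monom A S s = 0.
Proof. by rewrite /monom => /negPf ->; rewrite andbF. Qed.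

Lemma monom_swap A S q r s : monom A [:: q, r & S] s = monom A [:: r, q & S] s.
Proof.
rewrite /monom /indep /= [same A q r]same_sym !andbA.
congr (nat_of_bool (_ && _))%:R; first by congr (_ && _); rewrite andbAC.
by apply: eq_forallb => p; rewrite /minus_at /= orbCA.
Qed.

Lemma monom_same A S q r s : same A q r -> monom A (q :: S) s = monom A (r :: S) s.
Proof.
move=> qr; rewrite /monom /indep /=; congr (nat_of_bool (_ && (_ && _)))%:R.
  by congr (_ && _); apply: eq_all => p; rewrite (same_l qr).
by apply: eq_forallb => p; rewrite /minus_at /= (same_r qr).
Qed.

(** A basis state is the monomial of one representative arc for each component
    labelled v_-. *)
Lemma state_monom s : exists2 S, indep (edge_set s) S &
  forall t, (t == s)%:R = monom (edge_set s) S t.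
Proof.
pose cs := enum [pred c : bcomp (edge_set s) | tagged s c == false].
have hr c : exists q, bcomp_of (edge_set s) q == c.
  by have [q ->] := bcomp_of_surj c; exists q.
pose rep c := xchoose (hr c).
have repK c : bcomp_of (edge_set s) (rep c) = c by apply/eqP/(xchooseP (hr c)).
have fS : indep (edge_set s) (map rep cs).
  apply/indepP; split.
    rewrite map_inj_uniq; first exact: enum_uniq.
    by move=> c c' cc'; rewrite -[c]repK cc' repK.
  move=> _ _ /mapP[c _ ->] /mapP[c' _ ->].
  by rewrite -bcomp_of_eq !repK => /eqP->.
exists (map rep cs); first exact: fS.
move=> t; rewrite monom_indep; last exact: fS.
congr (_ == _)%:R.
apply: state_ext => // q; rewrite lab_mk; last exact: minus_at_invariant.
rewrite /minus_at; case lsq: (lab s q); apply/esym; last first.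
  apply/negbF/hasP; exists (rep (bcomp_of (edge_set s) q)); last first.
    by rewrite -bcomp_of_eq repK.
  by apply: map_f; rewrite mem_enum inE; apply/eqP.
apply/hasPn => _ /mapP[c + ->]; rewrite mem_enum inE => /eqP sc.
rewrite -bcomp_of_eq repK; apply/negP => /eqP qc.
by move: lsq; rewrite /lab qc sc.
Qed.

End States.

(** * The differential on monomials *)

Section Differential.

Variable G : ribbon_graph.
Implicit Types (A B : {set edge G}) (e f : edge G) (p q r : bdarc G).
Implicit Types (s t u : state G) (l : bdarc G -> label) (S : seq (bdarc G)).

(** The monomials whose sum is the image of the monomial [S] under the map of
    [e]: itself for a merge, its product with x_{e0} + x_{e1} for a split. *)
Definition edge_monoms e A S : seq (seq (bdarc G)) :=
  if splits A e then [:: foot e false :: S; foot e true :: S] else [:: S].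

Lemma forall_nearE B e l l' : invariant_lab B l -> invariant_lab B l' ->
  [forall q, l q == l' q] =
  [&& [forall q, ~~ near B e q ==> (l q == l' q)],
      l (foot e false) == l' (foot e false) & l (foot e true) == l' (foot e true)].
Proof.
move=> lB lB'; apply/forallP/and3P => [h|[/forallP h h0 h1] q].
  by split; rewrite ?h //; apply/forallP => q; rewrite h implybT.
have [|/(implyP (h q))//] := boolP (near B e q).
by case/orP => qe; rewrite (lB _ _ qe) (lB' _ _ qe).
Qed.

Lemma has_merged A e S : ~~ splits A e -> forall b,
  has (same (toggle e A) (foot e b)) S =
    has (same A (foot e false)) S || has (same A (foot e true)) S.
Proof.
move=> sA b; rewrite -has_predU; apply: eq_has => q /=.
rewrite same_merge // near_foot /=; rewrite /near !(same_sym _ q).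
by case: b => //; do 2 case: (same A _ q).
Qed.

(** Independent arcs remain so under a merge unless both merged components
    carry one of them, which is m(v_- (x) v_-) = 0. *)
Lemma indep_merged A e S : ~~ splits A e -> indep A S ->
  indep (toggle e A) S =
    ~~ (has (same A (foot e false)) S && has (same A (foot e true)) S).
Proof.
move=> sA /indepP[uS inj]; apply/indepP/idP => [[_ injB]|nh].
  apply/negP => /andP[/hasP[q qS q0] /hasP[r rS r1]].
  have nq : near A e q by rewrite /near same_sym q0.
  have nr : near A e r by rewrite /near [X in _ || X]same_sym r1 orbT.
  have qr : q = r by apply: injB => //; rewrite same_merge // nq nr orbT.
  by move/negP: sA; apply; apply: same_trans q0 _; rewrite qr same_sym.
split=> // q r qS rS; rewrite same_merge // => /orP[|/andP[nq nr]]; first exact: inj.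
have [b qb] := near_ex nq; have [c rc] := near_ex nr.
have hb : has (same A (foot e b)) S by apply/hasP; exists q; rewrite // same_sym.
have hc : has (same A (foot e c)) S by apply/hasP; exists r; rewrite // same_sym.
have [bc|] := eqVneq b c.
  by apply: inj => //; apply: same_trans qb _; rewrite bc same_sym.
by case: b c hb hc nh {qb rc} => [] [] // -> ->.
Qed.

Lemma indep_consE A q S : indep A (q :: S) = ~~ has (same A q) S && indep A S.
Proof. by rewrite /indep /= -all_predC. Qed.

Lemma indep_unmerged A e S : ~~ splits A e ->
  indep (toggle e A) S -> indep A S.
Proof.
move=> sA /indepP[uS inj]; apply/indepP; split=> // q r qS rS qr.
by apply: inj; rewrite // same_merge // qr.
Qed.

Lemma indep_cons_merged A e S (b : bool) : ~~ splits A e ->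
  indep A (foot e b :: S) -> indep (toggle e A) S.
Proof.
move=> sA; rewrite indep_consE => /andP[nh fS]; rewrite indep_merged //.
by case: b nh => /negPf ->; rewrite ?andbF.
Qed.

Lemma sum_monom A S (F : state G -> int) : indep A S ->
  \sum_s monom A S s * F s = F (mk_state A (minus_at A S)).
Proof.
move=> fS; rewrite (bigD1 (mk_state A (minus_at A S))) //= big1 ?addr0.
  by rewrite monom_indep // eqxx mul1r.
by move=> s sE; rewrite monom_indep // (negPf sE) mul0r.
Qed.

Lemma has_off A e q S : ~~ near A e q -> has (same (toggle e A) q) S = has (same A q) S.
Proof. by move=> nq; apply: eq_has => r; rewrite same_toggle_off. Qed.

(** The defining tables of m and Delta say exactly this, both on a basis state
    and, since both sides then vanish, on a monomial with a repeated
    component. *)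
Lemma edge_coef_monom A e S u : e \notin A ->
  \sum_s monom A S s * edge_coef e s u
    = \sum_(S' <- edge_monoms e A S) monom (e |: A) S' u.
Proof.
move=> eA; rewrite -(toggleU eA); set B := toggle e A.
have sB : splits B e = ~~ splits A e by rewrite splits_toggle.
have BA : toggle e B = A by rewrite toggleK.
have [iS|niS] := boolP (indep A S); last first.
  rewrite big1 => [|s _]; last by rewrite monom_dep ?mul0r.
  apply/esym; rewrite /edge_monoms; case: ifP => sA.
    rewrite big_cons big_seq1 !monom_dep ?addr0 //; apply: contra niS => fS;
    by rewrite -BA; apply: indep_cons_merged fS; rewrite sB sA.
  rewrite big_seq1 monom_dep //; apply: contra niS.
  by apply: indep_unmerged => //; rewrite sA.
rewrite sum_monom // /edge_coef eA /= -(toggleU eA) -/B.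
have [uB|uB] := eqVneq (edge_set u) B; last first.
  by apply/esym/big1 => S' _; rewrite /monom (negPf uB).
have luB : invariant_lab B (lab u) by rewrite -uB; apply: lab_invariant.
rewrite /monom; under eq_bigr => S' _ do
  rewrite uB eqxx andTb (forall_nearE e luB (@minus_at_invariant _ B S')).
rewrite /elab_coef !lab_mk; try exact: minus_at_invariant.
set l := lab u; set N := [forall q, ~~ near A e q ==> (l q == minus_at A S q)].
have -> : [forall q, ~~ near A e q ==> (lab (mk_state A (minus_at A S)) q == l q)] = N.
  by apply: eq_forallb => q; rewrite lab_mk 1?eq_sym //; exact: minus_at_invariant.
have NS : [forall q, ~~ near B e q ==> (l q == minus_at B S q)] = N.
  apply: eq_forallb => q; rewrite near_toggle; have [//|nq] := boolP (near A e q).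
  by rewrite /minus_at has_off.
have NfS b : [forall q, ~~ near B e q ==> (l q == minus_at B (foot e b :: S) q)] = N.
  rewrite -NS; apply: eq_forallb => q; rewrite /minus_at /= /near negb_or.
  by case: b; case: (same B q _); case: (same B q _).
rewrite /edge_monoms; case: (boolP (splits A e)) => sA; last first.
  have -> : l (foot e true) = l (foot e false).
    by apply: luB; rewrite same_sym; move: sB; rewrite (negPf sA).
  rewrite big_seq1 NS indep_merged // /minus_at !has_merged //.
  clearbody N; case: N {NS NfS} => /=; last by rewrite andbF.
  by case: (has _ S); case: (has _ S); case: (l _).
rewrite big_cons big_seq1 !NfS !indep_consE.
have sB' : ~~ splits B e by rewrite sB sA.
have iBS : indep B S by apply: (indep_unmerged sB'); rewrite BA.
have := indep_merged sB' iBS; rewrite BA iS iBS !andbT => /esym.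
(* Not both new circles carry an arc of S, so each case is one line of the
   table of Delta. *)
rewrite /minus_at -BA !(has_merged _ sB') /= !same_refl /=.
have -> : same B (foot e false) (foot e true) = false by apply: negbTE.
rewrite same_sym.
have -> : same B (foot e false) (foot e true) = false by apply: negbTE.
clearbody N; case: N {NS NfS} => /=; last by rewrite !andbF.
by case: (has _ S); case: (has _ S) => //=; case: (l _); case: (l _).
Qed.

End Differential.

(** * The square of the differential and the gradings *)

Section Complex.

Variable G : ribbon_graph.
Implicit Types (A B : {set edge G}) (e f : edge G) (p q r : bdarc G).
Implicit Types (s t u : state G) (l : bdarc G -> label) (S : seq (bdarc G)).

(** Both ways around a square of the cube change the number of components by
    the same amount, so they contain the same number of splits. *)
Lemma splits_exchange A e f : e \notin A -> f \notin A -> e != f ->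
  (splits A e + splits (e |: A) f = splits A f + splits (f |: A) e)%N.
Proof.
move=> eA fA ef; have := card_porbits_toggle A e; have := card_porbits_toggle A f.
have := card_porbits_toggle (toggle e A) f; have := card_porbits_toggle (toggle f A) e.
rewrite toggleC !toggleU // ?inE ?negb_or ?eA ?fA ?ef // 1?eq_sym ?ef //.
by do 4 case: (splits _ _) => /=; lia.
Qed.

Definition edge_comp e f s u : int := \sum_t edge_coef e s t * edge_coef f t u.

Lemma edge_comp_monom e f s u S : e \notin edge_set s -> f \notin e |: edge_set s ->
    (forall t, (t == s)%:R = monom (edge_set s) S t) ->
  edge_comp e f s u = \sum_(S' <- edge_monoms e (edge_set s) S)
    \sum_(S'' <- edge_monoms f (e |: edge_set s) S')
      monom (f |: (e |: edge_set s)) S'' u.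
Proof.
move=> eA fB sS.
have Es t : edge_coef e s t =
    \sum_(S' <- edge_monoms e (edge_set s) S) monom (e |: edge_set s) S' t.
  rewrite -edge_coef_monom // (bigD1 s) //= -sS eqxx mul1r big1 ?addr0 // => r rs.
  by rewrite -sS (negPf rs) mul0r.
rewrite /edge_comp; under eq_bigr do rewrite Es mulr_suml.
rewrite exchange_big /=; apply: eq_bigr => S' _.
exact: edge_coef_monom.
Qed.

Lemma edge_comp_id e s u : edge_comp e e s u = 0.
Proof.
rewrite /edge_comp big1 // => t _; rewrite /edge_coef.
case: ifP => [/andP[_ /eqP ->]|]; last by rewrite mul0r.
by rewrite !inE eqxx mulr0.
Qed.

Lemma edge_comp_in e f s u :
  (e \in edge_set s) || (f \in edge_set s) -> edge_comp e f s u = 0.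
Proof.
move=> efA; rewrite /edge_comp big1 // => t _; rewrite /edge_coef.
case: ifP => [/andP[eA /eqP ->]|]; last by rewrite mul0r.
by move: efA; rewrite (negPf eA) inE => /= ->; rewrite orbT mulr0.
Qed.

(** The chords [e] and [f] interlace on one circle of [A]; toggling both gives
    one circle back, on which all four feet lie. *)
Lemma same_interlaced A e f b c : splits A e -> splits A f ->
  ~~ splits (toggle e A) f -> same (toggle f (toggle e A)) (foot e b) (foot f c).
Proof.
set B := toggle e A => sAe sAf sBf; have sBe : ~~ splits B e.
  by rewrite splits_toggle sAe.
apply: near_merged => //; move: (sAf) (sBf); rewrite /splits -[A](toggleK e) -/B.
rewrite same_merge // => /orP[->//|/andP[n0 n1]] s01.
have [i0 h0] := near_ex n0; have [i1 h1] := near_ex n1.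
have i01 : i0 != i1.
  apply: contraNneq s01 => i01; apply: same_trans h0 _.
  by rewrite i01 same_sym.
rewrite /near ![same B (foot e b) _]same_sym.
by case: b i0 i1 i01 h0 h1 => [] [] [] // _ h0 h1; rewrite ?h0 ?h1 ?orbT.
Qed.

(** Both edges join the same two circles of [A]. After toggling both there are
    again two circles, and each edge has one foot on each of them. *)
Lemma same_parallel A e f : ~~ splits A e -> ~~ splits A f ->
    splits (toggle e A) f -> splits (toggle f A) e ->
  exists2 c, same (toggle f (toggle e A)) (foot e false) (foot f c)
           & same (toggle f (toggle e A)) (foot e true) (foot f (~~ c)).
Proof.
set B := toggle e A; set C := toggle f B => sAe sAf sBf sAfe.
have sCe : ~~ same C (foot e false) (foot e true).
  by rewrite /C /B toggleC [same _ _ _](splits_toggle _ e) sAfe.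
have nf b : near A e (foot f b).
  move: (sBf) (sAf); rewrite /splits same_merge // => /orP[->//|/andP[n0 n1] _].
  by case: b.
have fe b c : same B (foot f b) (foot e c) by apply: near_merged.
have : near C f (foot e true) by rewrite near_toggle /near same_sym fe.
have : near C f (foot e false) by rewrite near_toggle /near same_sym fe.
move=> /near_ex[c hc] /near_ex[c' hc']; exists c => //.
have [cc'|] := eqVneq c c'; last by case: c c' {hc} hc' => [] [].
by case/negP: sCe; apply: same_trans hc _; rewrite cc' same_sym.
Qed.

(** Both paths contain the same number of splits. If they split twice or
    never, they multiply by the same elements; likewise if each splits once,
    along the same edge. Otherwise one path splits along [e] and the other
    along [f], and the sums of the variables of the feet of [e] and of [f]
    agree in the group of the final edge set, for the geometric reasons of the
    two preceding lemmas. *)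
Lemma edge_compC e f s u : edge_comp e f s u = edge_comp f e s u.
Proof.
have [->//|ef] := eqVneq e f.
have [efA|] := boolP ((e \in edge_set s) || (f \in edge_set s)).
  by rewrite !edge_comp_in // orbC.
rewrite negb_or => /andP[eA fA]; have [S _ sS] := state_monom s.
have fB : f \notin e |: edge_set s by rewrite !inE negb_or eq_sym ef.
have eB : e \notin f |: edge_set s by rewrite !inE negb_or ef.
rewrite !(@edge_comp_monom _ _ _ _ S) //; set A := edge_set s in eA fA fB eB *.
have -> : f |: (e |: A) = e |: (f |: A) by rewrite !setUA [[set f] :|: _]setUC.
set C := e |: (f |: A).
have Ce : C = toggle e (toggle f A) by rewrite !toggleU // ?(toggleU fA).
have Cf : C = toggle f (toggle e A) by rewrite toggleC.
have := splits_exchange eA fA ef; rewrite /edge_monoms.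
have [eAE fAE] : toggle e A = e |: A /\ toggle f A = f |: A by rewrite !toggleU.
rewrite -eAE -fAE.
(* What remains after the impossible cases and those where both paths split
   along the same edges is: two splits on each path (in different orders), the
   interlaced case and the parallel case. *)
case se: (splits A e); case sf: (splits A f);
  case se': (splits (toggle f A) e); case sf': (splits (toggle e A) f) => //= _;
  rewrite ?(big_cons, big_nil) ?addr0 //.
- rewrite ![monom C [:: foot f _, foot e _ & S] u]monom_swap.
  by rewrite addrACA.
- have eqC b c : same C (foot e b) (foot f c).
    by rewrite Cf; apply: same_interlaced; rewrite ?se ?sf ?sf'.
  by rewrite !(monom_same _ _ (eqC false false)) (monom_same _ _ (eqC true true)).
- have [||||c h0 h1] := @same_parallel A e f; rewrite ?se ?sf ?se' ?sf' //.
  rewrite -Cf in h0 h1; rewrite (monom_same _ _ h0) (monom_same _ _ h1).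
  by case: c {h0 h1} => //; rewrite addrC.
Qed.

Lemma edge_signC A e f : e \notin A -> f \notin A -> e != f ->
  edge_sign e A * edge_sign f (e |: A) = - (edge_sign f A * edge_sign e (f |: A)).
Proof.
have sgn a b : a \notin A -> b != a ->
    edge_sign b (a |: A) = edge_sign b A * (-1) ^+ (a < b)%N.
  move=> aA ba; rewrite /edge_sign -exprD; congr (_ ^+ _).
  rewrite addnC.
  have -> : [set i in a |: A | (i < b)%N] =
     (if (a < b)%N then [set a] else set0) :|: [set i in A | (i < b)%N].
    apply/setP => i; rewrite !inE; case: ifP => ab; rewrite !inE;
    by have [->|] := eqVneq i a; rewrite ?ab //= ?(negPf aA).
  rewrite cardsU disjoint_setI0 ?cards0 ?subn0; last first.
    case: ifP => _; first by rewrite disjoints1 !inE negb_and aA.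
    by rewrite -setI_eq0 set0I.
  by case: ifP; rewrite ?cards1 ?cards0.
move=> eA fA ef; rewrite (sgn e f) // 1?eq_sym // (sgn f e) //.
have : (e < f)%N = ~~ (f < e)%N by rewrite -leqNgt ltn_neqAle ef.
move=> ->; case: (f < e)%N; rewrite /= ?expr0 ?expr1; ring.
Qed.

(** The terms of the double sum over pairs of edges are antisymmetric: the
    compositions commute and the signs anticommute. *)
Lemma state_coef_square s u : \sum_t state_coef s t * state_coef t u = 0.
Proof.
pose X e f :=
  edge_sign e (edge_set s) * edge_sign f (e |: edge_set s) * edge_comp e f s u.
have -> : \sum_t state_coef s t * state_coef t u = \sum_e \sum_f X e f.
  under eq_bigr do rewrite state_coefE mulr_suml.
  rewrite exchange_big; apply: eq_bigr => e _.
  under eq_bigr do rewrite state_coefE mulr_sumr.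
  rewrite exchange_big; apply: eq_bigr => f _; rewrite /X mulr_sumr.
  apply: eq_bigr => t _; rewrite /edge_coef; case: ifP => [/andP[_ /eqP ->]|].
    ring.
  by rewrite !(mulr0, mul0r).
have XC e f : X e f = - X f e.
  rewrite /X edge_compC; have [->|ef] := eqVneq e f.
    by rewrite edge_comp_id mulr0 oppr0.
  have [efA|] := boolP ((f \in edge_set s) || (e \in edge_set s)).
    by rewrite edge_comp_in // !mulr0 oppr0.
  by rewrite negb_or => /andP[fA eA]; rewrite edge_signC // mulNr.
set sX := LHS; have : sX = - sX.
  rewrite {1}/sX exchange_big -sumrN; apply: eq_bigr => e _.
  by rewrite -sumrN; apply: eq_bigr => f _; rewrite XC.
by lia.
Qed.

(** A component contributes -1 if it meets [S] and 1 otherwise, and [S] meets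
    as many components as it has members. *)
Lemma monom_bideg B S u : monom B S u != 0 ->
  state_bideg u = (#|B|%:Z, #|porbits (walk B)|%:Z - (size S).*2%:Z + #|B|%:Z).
Proof.
rewrite /monom; case: and3P => //= -[/eqP uB /indepP[uS inj] /forallP lu _].
case: u uB lu => [A x]; rewrite /edge_set /= => AB; case: B / AB inj => inj lu.
have x_minus : [pred c | x c == false] =i map (bcomp_of A) S.
  move=> c; rewrite !inE; have [q ->] := bcomp_of_surj c.
  have := lu q; rewrite /lab /= /minus_at => /eqP ->; rewrite eqbF_neg negbK.
  apply/hasP/mapP => -[r rS qr]; exists r => //; first exact/eqP.
  by rewrite -bcomp_of_eq qr.
have cardx : #|[pred c | x c == false]| = size S.
  rewrite (eq_card x_minus) -(size_map (bcomp_of A)); apply/card_uniqP.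
  rewrite map_inj_in_uniq // => q r qS rS qr; apply: inj => //.
  by rewrite -bcomp_of_eq qr.
congr (_, _ + _); have -> : #|porbits (walk A)| = #|{: bcomp A}| by rewrite card_sig.
rewrite -cardx; transitivity (\sum_(c : bcomp A) (1 - (x c == false)%:R *+ 2 : int)).
  by apply: eq_bigr => c _; case: (x c).
rewrite sumrB sumrMnl sumr_const -natr_sum natz; congr (_ - _).
  by rewrite natz.
have -> : #|[pred c | x c == false]| = (\sum_(c : bcomp A) (x c == false))%N.
  by rewrite -sum1_card big_mkcond; apply: eq_bigr => c _; rewrite inE; case: eqP.
by rewrite -muln2 PoszM -mulr_natr.
Qed.

(** A merge loses one component; a split gains one but multiplies by one more
    variable. Both lower the sum of the labels by one, which the shift by the
    number of edges makes up for. *)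
Lemma edge_coef_bideg e s u : edge_coef e s u != 0 ->
  state_bideg u = ((state_bideg s).1 + 1, (state_bideg s).2).
Proof.
have [S _ sS] := state_monom s; set A := edge_set s in sS *.
have [eA|eA] := boolP (e \in A); first by rewrite /edge_coef eA.
have := edge_coef_monom S u eA.
rewrite (bigD1 s) //= -sS eqxx mul1r big1 ?addr0; last first.
  by move=> r rs; rewrite -sS (negPf rs) mul0r.
move=> ->; have /monom_bideg -> : monom A S s != 0 by rewrite -sS eqxx.
have := card_porbits_toggle A e; rewrite toggleU // /edge_monoms /=.
have cA : #|e |: A| = #|A|.+1 by rewrite cardsU1 eA.
have cases b : monom (e |: A) (foot e b :: S) u != 0 -> splits A e ->
  (#|porbits (walk (e |: A))| = #|porbits (walk A)|.+1)%N ->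
  state_bideg u = (#|A|%:Z + 1, #|porbits (walk A)|%:Z - (size S).*2%:Z + #|A|%:Z).
  by move=> /monom_bideg-> _; rewrite cA => -> /=; congr (_, _); lia.
case: ifP => sA; rewrite /= ?double0 ?addn0 => cP.
  rewrite big_cons big_seq1.
  have [->|n0 _] := eqVneq (monom (e |: A) (foot e false :: S) u) 0.
    by rewrite add0r => /cases/(_ sA cP).
  exact: cases n0 sA cP.
by rewrite big_seq1 => /monom_bideg->; rewrite cA /=; congr (_, _); lia.
Qed.

Lemma state_coef_bideg s u : state_coef s u != 0 ->
  state_bideg u = ((state_bideg s).1 + 1, (state_bideg s).2).
Proof.
rewrite state_coefE => /sum_neq0[e]; rewrite mulf_eq0 negb_or => /andP[_].
exact: edge_coef_bideg.
Qed.

(** States with v_- on the marked component span a subcomplex. *)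
Lemma edge_coef_minus e s u p : edge_coef e s u != 0 ->
  lab s p = vminus -> lab u p = vminus.
Proof.
rewrite /edge_coef; case: ifP => // /andP[eA /eqP uB].
rewrite /elab_coef; case: ifP => // /forallP off.
have lu := @lab_invariant _ u; rewrite uB -(toggleU eA) in lu.
have [np|/(implyP (off p))/eqP-> //] := boolP (near (edge_set s) e p).
have [sA|sA] := boolP (splits (edge_set s) e) => n0 sp; last first.
  rewrite (lu _ _ (near_merged false sA np)).
  have : ~~ (lab s (foot e false) && lab s (foot e true)).
    by case/orP: np => /lab_invariant; rewrite sp => <-; rewrite ?andbF.
  by move: n0; do 3 case: (lab _ _).
have sp0 : lab s (foot e false) = false.
  case/orP: np => [/lab_invariant <- //|h].
  by rewrite (lab_invariant sA) -(lab_invariant h).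
have nB : near (toggle e (edge_set s)) e p by rewrite near_toggle.
by move: n0; rewrite sp0; case/orP: nB => /lu ->; do 2 case: (lab u _).
Qed.

End Complex.

(** * Cancelling along an innermost edge *)

Notation states_collapse X n :=
  (collapses (@state_bideg _) (@state_coef _) X n).

Section Peeling.

Variables (G : ribbon_graph) (p : bdarc G).
Implicit Types (A B T : {set edge G}) (D : {set edge G}) (e f : edge G).
Implicit Types (q r : bdarc G) (W S : {set bdarc G}).
Implicit Types (s t u : state G) (l : bdarc G -> label).

Lemma state_coef_neq0 s t : state_coef s t != 0 ->
  exists e, [/\ e \notin edge_set s, edge_set t = e |: edge_set s
              & elab_coef e (edge_set s) (lab s) (lab t) != 0].
Proof.
rewrite state_coefE => /sum_neq0[e]; rewrite mulf_eq0 negb_or => /andP[_].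
rewrite /edge_coef; case: ifP => // /andP[eA /eqP ts] n1.
by exists e.
Qed.

Lemma state_coef_edge e s t : e \notin edge_set s -> edge_set t = e |: edge_set s ->
  state_coef s t = edge_sign e (edge_set s) * elab_coef e (edge_set s) (lab s) (lab t).
Proof.
move=> es ts; rewrite state_coefE (bigD1 e) //= big1 ?addr0.
  by rewrite /edge_coef es ts eqxx.
move=> f fe; rewrite /edge_coef ts; case: ifP => [/andP[fs /eqP/setP/(_ f)]|].
  by rewrite !inE eqxx (negPf fe) (negPf fs).
by rewrite mulr0.
Qed.

(** [A] agrees with [T] outside [D]. The base point [T] may be any member of
    the range, in particular a quasi-tree, which avoids separate sets of edges
    forced in and forced out. *)
Definition between T D A : bool :=
  [forall f, (f \notin D) ==> ((f \in A) == (f \in T))].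

Lemma betweenP T D A :
  reflect (forall f, f \notin D -> (f \in A) = (f \in T)) (between T D A).
Proof.
apply: (iffP forallP) => h f; first by move=> fD; apply/eqP/(implyP (h f)).
by apply/implyP => /h ->.
Qed.

Lemma between_refl T D : between T D T. Proof. exact/betweenP. Qed.

Lemma between_base T D A : between T D A -> between T D =1 between A D.
Proof.
move=> /betweenP TA B; apply/betweenP/betweenP => h f fD; by rewrite h // TA.
Qed.

Definition block T D W l : {set state G} :=
  [set s | [&& between T D (edge_set s), lab s p == vminus &
    [forall q in W, lab s q == l q]]].

(** [W] is the union of the circles already cut off: the walk preserves it and
    no edge of [D] has a foot on it, so these circles are the same for every
    edge set of the range. *)
Definition dead T D W : Prop :=
  [/\ p \notin W, {in W, forall q, walk T q \in W}
    & {in D, forall f b, foot f b \notin W}].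

Lemma dead_walk T D W A : dead T D W -> between T D A -> {in W, walk T =1 walk A}.
Proof.
move=> [_ _ WD] /betweenP TA [[f b]|v] qW; last by rewrite !permE.
apply: walk_eq; rewrite /= TA //; apply/negP => /WD/(_ b).
by rewrite qW.
Qed.

Lemma dead_base T D W A : dead T D W -> between T D A -> dead A D W.
Proof.
by move=> dW TA; have [pW WW WD] := dW; split=> // q qW; rewrite -(dead_walk dW TA) ?WW.
Qed.

Lemma dead_same T D W A q r : dead T D W -> between T D A -> q \in W ->
  same A q r = same T q r.
Proof.
move=> dW TA qW; rewrite !same_mem.
suff -> : porbit (walk A) q = porbit (walk T) q by [].
apply/esym; apply: (@eq_in_porbit _ (walk T) (walk A) (mem W)) qW.
  by case: dW.
exact: dead_walk dW TA.
Qed.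

Lemma dead_closed T D W q r : dead T D W -> q \in W -> same T q r -> r \in W.
Proof.
move=> [_ WW _] qW; rewrite same_mem => /porbitP[i ->].
elim: i => [|i IH]; first by rewrite expg0 perm1.
by rewrite expgSr permM WW.
Qed.

(** Here [S] is one circle of [T], it carries the foot [x] of [e] and no foot
    of the edges of [D], and the other foot [y] of [e] lies elsewhere.
    Toggling [e] thus merges [S] into another circle, for every edge set that
    agrees with [T] outside [D]. *)
Section Matching.

Variables (T D : {set edge G}) (W S : {set bdarc G}) (l : bdarc G -> label).
Variables (e : edge G) (i : bool).

Let x := foot e (~~ i).
Let y := foot e i.

Hypothesis eD : e \notin D.
Hypothesis deadWS : dead T D (W :|: S).
Hypothesis yWS : y \notin W :|: S.
Hypothesis WS : [disjoint W & S].
Hypothesis Sx : forall q, q \in S = same T q x.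

Let xS : x \in S. Proof. by rewrite Sx same_refl. Qed.

Let pS : p \notin S.
Proof. by case: deadWS => + _ _; rewrite inE negb_or => /andP[]. Qed.

Let yS : y \notin S. Proof. by move: yWS; rewrite inE negb_or => /andP[]. Qed.

Let WnS q : q \in W -> q \notin S.
Proof. by move=> qW; rewrite (disjointFr WS qW). Qed.

Lemma side_same A q : between T D A -> (q \in S) = same A q x.
Proof.
by move=> TA; rewrite Sx ![same _ q x]same_sym (dead_same _ deadWS TA) // inE xS orbT.
Qed.

Lemma side_splits A : between T D A -> splits A e = false.
Proof.
move=> TA; apply: contraNF yS; rewrite (side_same _ TA) /splits /x /y.
by case: i => //; rewrite same_sym.
Qed.

Lemma near_side A q : between T D A -> near A e q = (q \in S) || same A q y.
Proof.
move=> TA; rewrite (side_same _ TA) /near /x /y.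
by case: i => //=; rewrite orbC.
Qed.

(** The edge sets of [split_side] have the same status of [e] as [T], so that
    [S] is a component, and those of [merged_side] the opposite status. Which
    of the two comes first in the cube depends on whether [e] belongs to [T].
    *)
Definition split_side b : {set state G} := [set s in block T D W l | lab s x == b].

Definition merged_side : {set state G} := block (toggle e T) D W l.

Lemma between_toggle A : between (toggle e T) D (toggle e A) = between T D A.
Proof.
apply/betweenP/betweenP => h f fD; move: (h f fD); rewrite !in_toggle.
  by move=> /addbI.
by move=> ->.
Qed.

Definition split_lab b s q : label := if q \in S then b else lab s q.
Definition merge_lab s q : label := if q \in S then lab s y else lab s q.

Definition split_state b s := mk_state (toggle e (edge_set s)) (split_lab b s).
Definition merge_state s := mk_state (toggle e (edge_set s)) (merge_lab s).

Lemma split_labE b s : between (toggle e T) D (edge_set s) ->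
  lab (split_state b s) =1 split_lab b s.
Proof.
rewrite -{1}[edge_set s](toggleK e) between_toggle => TA; apply: lab_mk => q r qr.
rewrite /split_lab (side_same _ TA) (side_same _ TA) (same_l qr).
case: ifP => // _; apply: lab_invariant.
by rewrite -[edge_set s](toggleK e) same_merge ?qr // side_splits.
Qed.

Lemma merge_labE s : between T D (edge_set s) -> lab (merge_state s) =1 merge_lab s.
Proof.
move=> TA; apply: lab_mk => q r; rewrite same_merge ?side_splits // => /orP[qr|].
  rewrite /merge_lab (side_same _ TA) (side_same _ TA) (same_l qr).
  by case: ifP => // _; apply: lab_invariant.
suff nE z : near (edge_set s) e z -> merge_lab s z = lab s y.
  by case/andP => /nE-> /nE->.
rewrite near_side // /merge_lab; case: (z \in S) => //=; exact: lab_invariant.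
Qed.

Lemma split_state_in b s : s \in merged_side -> split_state b s \in split_side b.
Proof.
rewrite !inE => /and3P[TA lp /forallP lW]; rewrite !split_labE // /split_lab.
rewrite (negPf pS) lp xS eqxx andbT -between_toggle toggleK TA /=.
apply/forallP => q; apply/implyP => qW; rewrite split_labE // /split_lab.
by rewrite (negPf (WnS qW)) (implyP (lW q)).
Qed.

Lemma merge_state_in b s : s \in split_side b -> merge_state s \in merged_side.
Proof.
rewrite !inE => /andP[/and3P[TA lp /forallP lW] _]; rewrite !merge_labE // /merge_lab.
rewrite (negPf pS) lp between_toggle TA /=.
apply/forallP => q; apply/implyP => qW; rewrite merge_labE // /merge_lab.
by rewrite (negPf (WnS qW)) (implyP (lW q)).
Qed.

Lemma split_stateK b s : s \in merged_side -> merge_state (split_state b s) = s.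
Proof.
move=> sM; have := split_state_in b sM; rewrite inE => /andP[+ _].
rewrite inE => /andP[TA _].
move: sM; rewrite inE => /andP[TM _].
apply: state_ext => [|q]; first by rewrite /edge_set /= toggleK.
rewrite merge_labE // /merge_lab !split_labE // /split_lab (negPf yS).
have [qS|//] := boolP (q \in S); apply: lab_invariant.
rewrite -[edge_set s](toggleK e) same_merge; last by rewrite side_splits.
by rewrite !near_side // qS same_refl !orbT.
Qed.

Lemma merge_stateK b s : s \in split_side b -> split_state b (merge_state s) = s.
Proof.
move=> sM; have := merge_state_in sM; rewrite inE => /andP[TM _].
move: sM; rewrite 2!inE => /andP[/andP[TA _] /eqP lx].
apply: state_ext => [|q]; first by rewrite /edge_set /= toggleK.
rewrite split_labE // /split_lab merge_labE // /merge_lab.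
have [|//] := boolP (q \in S).
by rewrite (side_same _ TA) => /lab_invariant->.
Qed.

(** The label of [S] is left out: this is the relation between the two ends of
    a nonzero coefficient of m when [S] is labelled v_+, and of Delta when [S]
    is labelled v_-. *)
Definition agree s t : bool :=
  [forall q, ~~ near (edge_set s) e q ==> (lab s q == lab t q)] && (lab s y == lab t y).

(** Agreement determines each state from the other one, once the label of [S]
    is fixed. *)
Lemma agreeE b s t : s \in split_side b -> t \in merged_side ->
  edge_set t = toggle e (edge_set s) -> agree s t = (t == merge_state s).
Proof.
move=> sY tM st; move: sY tM; rewrite !inE => /andP[/and3P[TA _ _] lx] /and3P[TM _ _].
apply/andP/eqP => [[/forallP off /eqP ly]|->].
  apply: state_ext => // q; rewrite merge_labE // /merge_lab.
  have [nq|nq] := boolP (near (edge_set s) e q); last first.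
    move: (nq); rewrite near_side // negb_or => /andP[/negPf-> _].
    by apply/esym/eqP/(implyP (off q)).
  have -> : lab t q = lab t y.
    apply: lab_invariant; rewrite st same_merge ?side_splits // nq.
    by rewrite near_side // same_refl !orbT.
  rewrite -ly; move: nq; rewrite near_side //; case: (q \in S) => //=.
  by move=> /lab_invariant.
split; last by rewrite merge_labE // /merge_lab (negPf yS).
apply/forallP => q; apply/implyP; rewrite near_side // negb_or => /andP[/negPf qS _].
by rewrite merge_labE // /merge_lab qS.
Qed.

(** The circle [S] carries no foot of an edge of [D], so no edge map between
    two states of this side changes its label. *)
Lemma state_coef_split_side b b' s t : s \in split_side b -> t \in split_side b' ->
  b != b' -> state_coef s t = 0.
Proof.
rewrite !inE => /andP[/and3P[TA _ _] /eqP<-] /andP[/and3P[TB _ _] /eqP<-].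
apply: contraNeq => /state_coef_neq0[f [fs ts]].
rewrite /elab_coef; case: ifP => // /forallP/(_ x)/implyP off _; apply: off.
have fD : f \in D.
  apply: contraR fs => fD.
  rewrite (elimT (betweenP _ _ _) TA) // -(elimT (betweenP _ _ _) TB) // ts.
  by rewrite !inE eqxx.
have [_ _ WD] := deadWS; rewrite /near ![same _ x _]same_sym.
rewrite -!(side_same _ TA) negb_or.
by do 2 (have := WD f fD false; have := WD f fD true);
  rewrite !inE !negb_or => /andP[_ ->] /andP[_ ->].
Qed.

(** v_+ is the unit of m. *)
Lemma elab_coef_merge A l1 l2 : ~~ splits A e -> invariant_lab (toggle e A) l2 ->
    l1 x = true ->
  elab_coef e A l1 l2 =
    ([forall q, ~~ near A e q ==> (l1 q == l2 q)] && (l1 y == l2 y))%:R.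
Proof.
move=> sA l2A l1x; rewrite /elab_coef (negPf sA); case: ifP => // _.
have l2e : l2 (foot e false) = l2 (foot e true).
  by apply: l2A; have := splits_toggle A e; rewrite sA.
move: l1x; rewrite /x /y; case: i => /= ->; rewrite l2e;
by do 2 case: (_ (foot _ _)).
Qed.

(** v_+ is sent to v_+ (x) v_- and v_- to v_- (x) v_- by Delta followed by the
    projection to v_- on one factor. *)
Lemma elab_coef_split A l1 l2 : splits A e -> invariant_lab A l1 ->
    l2 x = false ->
  elab_coef e A l1 l2 =
    ([forall q, ~~ near A e q ==> (l1 q == l2 q)] && (l1 y == l2 y))%:R.
Proof.
move=> sA l1A l2x; rewrite /elab_coef sA; case: ifP => // _.
have l1e : l1 (foot e true) = l1 (foot e false) by apply/esym/l1A.
move: l2x; rewrite /x /y; case: i => /= ->; rewrite ?l1e;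
by do 2 case: (_ (foot _ _)).
Qed.

Lemma split_side_edges b s : s \in split_side b -> (e \in edge_set s) = (e \in T).
Proof. by rewrite !inE => /andP[/and3P[/betweenP-> //]]. Qed.

Lemma merged_side_edges t : t \in merged_side -> (e \in edge_set t) = (e \notin T).
Proof. by rewrite !inE => /and3P[/betweenP-> //]; rewrite in_toggle eqxx. Qed.

Lemma state_coef_merge s t : e \notin T -> s \in split_side true -> t \in merged_side ->
  edge_set t = toggle e (edge_set s) ->
  state_coef s t = edge_sign e (edge_set s) * (t == merge_state s)%:R.
Proof.
move=> eT sY tM st; have es : e \notin edge_set s by rewrite (split_side_edges sY).
rewrite (state_coef_edge es) -?toggleU // -(agreeE sY) //.
move: sY; rewrite !inE => /andP[/and3P[TA _ _] /eqP lx].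
rewrite elab_coef_merge // ?side_splits // -st; exact: lab_invariant.
Qed.

Lemma state_coef_unsplit s t : e \in T -> s \in split_side false -> t \in merged_side ->
  edge_set t = toggle e (edge_set s) ->
  state_coef t s = edge_sign e (edge_set t) * (t == merge_state s)%:R.
Proof.
move=> eT sY tM st; have es : e \notin edge_set t by rewrite (merged_side_edges tM) eT.
have ts : edge_set s = toggle e (edge_set t) by rewrite st toggleK.
rewrite (state_coef_edge es) -?toggleU // -(agreeE sY) //.
move: sY; rewrite !inE => /andP[/and3P[TA _ _] /eqP lx].
have tS : splits (edge_set t) e by rewrite st splits_toggle side_splits.
rewrite (elab_coef_split tS (@lab_invariant _ t) lx).
congr (edge_sign _ _ * (nat_of_bool (_ && _))%:R); last exact: eq_sym.
by apply: eq_forallb => q; rewrite st near_toggle eq_sym.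
Qed.

Lemma sides_disjoint b : [disjoint split_side b & merged_side].
Proof.
rewrite -setI_eq0; apply/eqP/setP => s; rewrite in_set0.
apply/negP => /setIP[sY sM]; have := split_side_edges sY; have := merged_side_edges sM.
by move=> ->; case: (e \in T).
Qed.

Lemma state_coef_toggle s t :
  state_coef s t != 0 -> e \notin edge_set s -> e \in edge_set t ->
  edge_set t = toggle e (edge_set s).
Proof.
move=> /state_coef_neq0[f [fs -> _]] es; rewrite !inE (negPf es) orbF => /eqP->.
by rewrite toggleU.
Qed.

(** If [e] is not in [T], adding it merges [S], and the label v_+ on [S] is
    cancelled; if [e] is in [T], adding it splits [S] off, and the label v_-
    is cancelled. *)
Lemma matched_collapses :
  states_collapse
    (split_side (e \notin T) :|: merged_side) 0.
Proof.
have unit_sqr A (b : bool) : b -> (edge_sign e A * b%:R) ^+ 2 = 1 :> int.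
  by move=> ->; rewrite mulr1 /edge_sign sqrr_sign.
have [eT|eT] /= := boolP (e \in T).
  have coef1 : {in merged_side,
      forall t, state_coef t (split_state false t) ^+ 2 = 1}.
    move=> t tM; have sY := split_state_in false tM.
    rewrite (state_coef_unsplit eT sY tM) ?unit_sqr ?split_stateK //.
    by rewrite /edge_set /= toggleK.
  rewrite setUC.
  apply: (@collapses_matching _ _ _ _ _ (split_state false) merge_state) => //.
  - by rewrite disjoint_sym sides_disjoint.
  - by move=> t; apply: split_state_in.
  - by move=> s; apply: merge_state_in.
  - by move=> t; apply: split_stateK.
  - by move=> s; apply: merge_stateK.
  - move=> t s tM sY n0; have st : edge_set s = toggle e (edge_set t).
      apply: state_coef_toggle; rewrite ?(split_side_edges sY) ?(merged_side_edges tM) //.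
      by rewrite eT.
    move: n0; rewrite (state_coef_unsplit eT sY tM) ?st ?toggleK //.
    by case: (t =P merge_state s) => [-> _|]; rewrite ?merge_stateK ?mulr0.
  - move=> t tM; apply/eqP/state_coef_bideg; apply/eqP => d0.
    by have := coef1 t tM; rewrite d0 expr0n.
have coef1 : {in split_side true,
    forall s, state_coef s (merge_state s) ^+ 2 = 1}.
  move=> s sY; have tM := merge_state_in sY.
  by rewrite (state_coef_merge eT sY tM) ?unit_sqr.
apply: (@collapses_matching _ _ _ _ _ merge_state (split_state true)) => //.
- exact: sides_disjoint.
- by move=> s; apply: merge_state_in.
- by move=> t; apply: split_state_in.
- by move=> s; apply: merge_stateK.
- by move=> t; apply: split_stateK.
- move=> s t sY tM n0; have st : edge_set t = toggle e (edge_set s).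
    by apply: state_coef_toggle; rewrite ?(split_side_edges sY) ?(merged_side_edges tM).
  move: n0; rewrite (state_coef_merge eT sY tM) //.
  by case: (t =P merge_state s) => //; rewrite mulr0.
- move=> t tM; apply/eqP/state_coef_bideg; apply/eqP => d0.
  by have := coef1 t tM; rewrite d0 expr0n.
Qed.

(** The label of [S] that survives the cancellation. *)
Definition peeled_lab q : label := if q \in W then l q else e \in T.

Lemma block_split_side : block T D (W :|: S) peeled_lab = split_side (e \in T).
Proof.
apply/setP => s; rewrite !inE -!andbA.
case: (between T D (edge_set s)) / boolP => //= TA.
congr (_ && _); apply/forallP/andP => [h|[/forallP h /eqP lx] q].
  split; last first.
    have := implyP (h x); rewrite inE xS orbT /peeled_lab => /(_ isT).
    by case: ifP => // /WnS; rewrite xS.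
  apply/forallP => q; apply/implyP => qW; have := implyP (h q).
  by rewrite /peeled_lab inE qW; apply.
rewrite inE /peeled_lab; have [qW|qW] /= := boolP (q \in W).
  exact: (implyP (h q)).
by apply/implyP; rewrite (side_same _ TA) => /lab_invariant->; apply/eqP.
Qed.

Lemma between_addD A :
  between T (e |: D) A = between T D A || between (toggle e T) D A.
Proof.
apply/betweenP/orP => [h|[] /betweenP h f].
- have [eA|eA] := eqVneq (e \in A) (e \in T); [left|right]; apply/betweenP => f fD.
    by have [->//|fe] := eqVneq f e; rewrite h // !inE negb_or fe.
  rewrite in_toggle; have [->|fe] := eqVneq f e; last by rewrite h // !inE negb_or fe.
  by move: eA; case: (e \in A); case: (e \in T).
- by rewrite !inE negb_or => /andP[_ /h].
- by rewrite !inE negb_or => /andP[fe /h]; rewrite in_toggle (negPf fe).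
Qed.

Lemma block_peel : block T (e |: D) W l =
  split_side (e \in T) :|: (split_side (e \notin T) :|: merged_side).
Proof.
apply/setP => s; rewrite !inE between_addD andb_orl orbA -andb_orr.
congr (_ || _); rewrite -[LHS]andbT; congr (_ && _).
by case: (lab s x); case: (e \in T).
Qed.

(** What survives is again a block, with one more dead circle and one edge
    less. The surviving states form the last step of the filtration when [e]
    is in [T] and the first one otherwise, hence the two orders in the union.
    *)
Lemma collapses_peel n :
  states_collapse (block T D (W :|: S) peeled_lab) n ->
  states_collapse (block T (e |: D) W l) n.
Proof.
rewrite block_split_side block_peel => collY; have collM := matched_collapses.
have dr s t : state_coef s t != 0 -> raises (@state_bideg G) s t.
  by move=> /state_coef_bideg/eqP.
have disj : [disjoint split_side (e \in T) & split_side (e \notin T) :|: merged_side].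
  rewrite -setI_eq0 setIUr (disjoint_setI0 (sides_disjoint _)) setU0.
  apply/eqP/setP => s; rewrite in_set0; apply/negP => /setIP[].
  rewrite inE => /andP[_ /eqP ls]; rewrite inE => /andP[_].
  by rewrite ls; case: (e \in T).
have decr s t : e \in edge_set s -> e \notin edge_set t -> state_coef s t = 0.
  move=> es; apply: contraNeq => /state_coef_neq0[f [_ -> _]].
  by rewrite inE es orbT.
move: collY collM disj; have [eT|eT] := boolP (e \in T) => /= collY collM disj.
  rewrite setUC -[n]add0n; apply: collapses_union => //.
    by rewrite disjoint_sym.
  move=> s t sY /setUP[tY|tM]; first exact: state_coef_split_side sY tY _.
  by apply: decr; rewrite ?(split_side_edges sY) ?(merged_side_edges tM) ?eT.
rewrite -[n]addn0; apply: collapses_union => //.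
move=> s t /setUP[sY|sM] tY; first exact: state_coef_split_side sY tY _.
by apply: decr; rewrite ?(split_side_edges tY) ?(merged_side_edges sM).
Qed.

End Matching.

End Peeling.

(** * The recursion on the edges *)

Section Induction.

Variables (G : ribbon_graph) (p : bdarc G).
Implicit Types (A B T : {set edge G}) (D : {set edge G}) (e f : edge G).
Implicit Types (q r : bdarc G) (W S : {set bdarc G}).
Implicit Types (s t u : state G) (l : bdarc G -> label).

(** Quasi-trees relative to the dead circles [W]: everything else is one
    boundary component, that of the marked arc. *)
Definition all_live W A : bool := [forall q, (q \notin W) ==> same A q p].

Lemma all_liveP W A : reflect (forall q, q \notin W -> same A q p) (all_live W A).
Proof. by apply: (iffP forallP) => h q; apply/implyP; apply: h. Qed.

Definition live_trees T D W : {set {set edge G}} :=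
  [set A | between T D A && all_live W A].

(** Toggling [e] cuts the circle of a quasi-tree [T] in two; this is the part
    without the marked arc. *)
Definition far_side W T e : {set bdarc G} :=
  [set q | (q \notin W) && ~~ same (toggle e T) q p].

(** The case of a range with a single quasi-tree [T]. *)
Section Leaf.

Variables (T D : {set edge G}) (W : {set bdarc G}).
Hypothesis deadW : dead p T D W.
Hypothesis liveT : all_live W T.
Hypothesis uniqT : forall A, between T D A -> all_live W A -> A = T.

Lemma foot_notin_dead e b : e \in D -> foot e b \notin W.
Proof. by case: deadW => _ _ /[apply]; apply. Qed.

Lemma p_notin_dead : p \notin W. Proof. by case: deadW. Qed.

Lemma toggle_merges e : e \in D -> splits (toggle e T) e = false.
Proof.
move=> eD; rewrite splits_toggle; apply/negbTE/negPn.
have h b := all_liveP _ _ liveT _ (foot_notin_dead b eD).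
by apply: same_trans (h _) _; rewrite same_sym.
Qed.

Lemma near_toggled e q : e \in D -> q \notin W -> near (toggle e T) e q.
Proof.
move=> eD qW; rewrite near_toggle /near; apply/orP; left.
apply: same_trans (all_liveP _ _ liveT _ qW) _.
by rewrite same_sym; apply: (all_liveP _ _ liveT); apply: foot_notin_dead.
Qed.

Lemma between_toggle_in e B : e \in D -> between T D B -> between T D (toggle e B).
Proof.
move=> eD /betweenP TB; apply/betweenP => f fD; rewrite in_toggle TB //.
by have [fe|] := eqVneq f e; first by rewrite fe eD in fD.
Qed.

(** The feet of [f] are not separated by [e], that is, the chords do not
    interlace: otherwise toggling both gives a second quasi-tree in the range.
    *)
Lemma toggle_splits e f : e \in D -> f \in D -> f != e -> splits (toggle e T) f.
Proof.
move=> eD fD fe; apply/negPn/negP => nsf; set B := toggle e T in nsf.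
have nf q : q \notin W -> near B f q.
  move=> qW; have n b := near_toggled eD (foot_notin_dead b fD).
  have [c qc] := near_ex (near_toggled eD qW).
  have [c0 f0] := near_ex (n false); have [c1 f1] := near_ex (n true).
  have c01 : c0 != c1.
    apply: contraNneq nsf => c01; apply: same_trans f0 _.
    by rewrite c01 same_sym.
  apply/orP; have [cc|cc] := eqVneq c c0; [left|right]; apply: same_trans qc _.
    by rewrite cc same_sym.
  suff -> : c = c1 by rewrite same_sym.
  by case: c c0 c1 cc c01 {f0 f1} => [] [] [].
have /setP/(_ e) : toggle f B = T.
  apply: uniqT; first exact/between_toggle_in/between_toggle_in/between_refl.
  apply/all_liveP => q qW; apply: same_trans (near_merged false nsf (nf _ qW)) _.
  by rewrite same_sym near_merged // nf // p_notin_dead.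
by rewrite !in_toggle eqxx eq_sym (negPf fe); case: (e \in T).
Qed.

(** For chords that do not interlace, a chord with a foot on the far side of
    another lies entirely there and cuts off strictly less. *)
Lemma far_side_smaller e f b : e \in D -> f \in D -> f != e ->
  foot f b \in far_side W T e -> far_side W T f \proper far_side W T e.
Proof.
move=> eD fD fe fS; set B := toggle e T; set B' := toggle f T.
have sBf : splits B f by apply: toggle_splits.
have sB'e : splits B' e by apply: toggle_splits; rewrite // eq_sym.
have npf c : ~~ same B (foot f c) p.
  move: fS; rewrite inE -/B => /andP[_]; apply: contra => fp.
  by apply: same_trans _ fp; case: b c => [] []; rewrite ?same_refl // same_sym.
have npB : ~~ near B f p by rewrite /near negb_or !(same_sym _ p) !npf.
apply/properP; split.
  apply/subsetP => q; rewrite !inE => /andP[qW nq]; rewrite qW; apply: contra nq => qp.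
  have nqB : ~~ near B f q by rewrite (near_same _ qp).
  have sC : ~~ splits (toggle e B') e by rewrite splits_toggle sB'e.
  rewrite -/B' -[B'](toggleK e) same_merge // {1}/B' toggleC -/B.
  by rewrite same_toggle_off // qp.
have [c pc] := near_ex (near_toggled fD p_notin_dead).
exists (foot f c); rewrite inE foot_notin_dead //=.
by rewrite negbK same_sym.
Qed.

(** An edge with the smallest far side. *)
Lemma innermost_edge : D != set0 -> exists2 e, e \in D &
  {in D, forall f, f != e -> forall b, foot f b \notin far_side W T e}.
Proof.
case/set0Pn => e0 e0D; case: (arg_minnP (fun e => #|far_side W T e|) e0D) => e eD emin.
exists e => // f fD fe b; apply/negP => fS.
have := proper_card (far_side_smaller eD fD fe fS).
by rewrite ltnNge emin.
Qed.

(** The range obtained by peeling off the far side of an innermost edge again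
    has exactly one quasi-tree, since merging that circle back by toggling [e]
    gives a quasi-tree of the given range. *)
Lemma leaf_peel l : D != set0 -> (forall q r, q \in W -> same T q r -> l q = l r) ->
  exists e W' l', let B := toggle e T in
    [/\ [/\ e \in D, dead p B (D :\ e) W' & all_live W' B],
        forall q r, q \in W' -> same B q r -> l' q = l' r,
        live_trees B (D :\ e) W' = [set B]
      & forall n, states_collapse (block p B (D :\ e) W' l') n ->
          states_collapse (block p T D W l) n].
Proof.
move=> D0 lW; have [e eD emin] := innermost_edge D0.
set B := toggle e T; set S := far_side W T e; set D' := D :\ e.
have TB : between T D B by apply/between_toggle_in/between_refl.
have dWB : dead p B D' W.
  by have [pW WW WD] := dead_base deadW TB; split=> // f /setD1P[_ /WD].
have eD' : e \notin D' by rewrite !inE eqxx.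
have ns : ~~ splits B e by rewrite toggle_merges.
have [i ip] := near_ex (near_toggled eD p_notin_dead).
have xy : ~~ same B (foot e (~~ i)) (foot e i).
  by case: i {ip} => //=; rewrite same_sym.
have WS : [disjoint W & S].
  by rewrite -setI_eq0; apply/eqP/setP => q; rewrite !inE; case: (q \in W).
have Wcl q r : q \in W -> same B q r -> r \in W by apply: dead_closed dWB.
have Sx q : (q \in S) = same B q (foot e (~~ i)).
  rewrite inE -/B; apply/andP/idP => [[qW nqp]|qx].
    have nqy : ~~ same B q (foot e i).
      by apply: contra nqp => qy; apply: same_trans qy _; rewrite same_sym.
    by have := near_toggled eD qW; rewrite /near -/B; case: i nqy {ip xy} => /negPf ->;
       rewrite ?orbF.
  have qW : q \notin W.
    by apply: contra (foot_notin_dead (~~ i) eD) => qW; apply: Wcl qW qx.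
  split=> //; apply: contra xy => qp; apply: same_trans ip.
  by apply: same_trans _ qp; rewrite same_sym.
have dWS : dead p B D' (W :|: S).
  have [pW WW WD] := dWB; split.
  - by rewrite !inE same_refl andbF orbF.
  - move=> q /setUP[qW|qS]; first by rewrite inE WW.
    by rewrite inE [_ \in S]Sx (same_l (same_walk B q)) -Sx qS orbT.
  - move=> f fD b; rewrite inE negb_or WD // emin //; by case/setD1P: fD.
have yWS : foot e i \notin W :|: S.
  by rewrite inE negb_or foot_notin_dead //= Sx same_sym.
have gB : all_live (W :|: S) B.
  by apply/all_liveP => q; rewrite !inE negb_or => /andP[-> /=]; rewrite negbK.
exists e, (W :|: S), (peeled_lab B W l e); split=> //.
- move=> q r; rewrite /peeled_lab inE => qWS qr.
  have [qW|qW] /= := boolP (q \in W).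
    rewrite (Wcl _ _ qW qr); apply: lW => //.
    by rewrite -(dead_same _ deadW TB).
  case: ifP => // rW; case/negP: qW; apply: Wcl rW _; by rewrite same_sym.
- apply/setP => A; rewrite !inE; apply/andP/eqP => [[BA gA]|->]; last first.
    by split=> //; apply: between_refl.
  have AT : between T D A.
    apply/betweenP => f fD; have [_ _ _] := dWS.
    rewrite (elimT (betweenP _ _ _) BA) ?(elimT (betweenP _ _ _) TB) //.
    by rewrite inE negb_and fD orbT.
  rewrite -[A](toggleK e); congr toggle; apply: uniqT; first exact: between_toggle_in.
  have SA : forall q, (q \in S) = same A q (foot e (~~ i)).
    by move=> q; apply: side_same BA; eassumption.
  have py : same A p (foot e i) by rewrite same_sym; apply: (all_liveP _ _ gA).
  have near_A q : q \notin W -> near A e q.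
    move=> qW; suff [c qc] : exists c, same A q (foot e c).
      by rewrite /near; case: c qc => ->; rewrite ?orbT.
    have [qS|qS] := boolP (q \in S); first by exists (~~ i); rewrite -SA.
    exists i; apply: same_trans py; apply: (all_liveP _ _ gA).
    by rewrite inE negb_or qW.
  have nsA : ~~ splits A e.
    apply: contra yWS; rewrite inE SA /splits => sA; apply/orP; right.
    by case: (i); rewrite // same_sym.
  apply/all_liveP => q qW; apply: same_trans (near_merged false nsA (near_A _ qW)) _.
  by rewrite same_sym near_merged // near_A // p_notin_dead.
- move=> n; move/(collapses_peel eD' dWS yWS WS Sx); rewrite setD1K //.
  suff -> : block p B D W l = block p T D W l by [].
  by apply/setP => s; rewrite !inE (between_base TB).
Qed.

End Leaf.

Lemma block_set0 T W l : dead p T set0 W -> all_live W T ->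
    (forall q r, q \in W -> same T q r -> l q = l r) ->
  block p T set0 W l = [set mk_state T (fun q => if q \in W then l q else vminus)].
Proof.
move=> dW gT lW; set l0 := fun q => _.
have l0T : invariant_lab T l0.
  move=> q r qr; rewrite /l0; have -> : (r \in W) = (q \in W).
    by apply/idP/idP => xW; apply: dead_closed dW xW _; rewrite // same_sym.
  by case: ifP => // qW; apply: lW.
have l0p : l0 p = vminus by rewrite /l0; case: dW => /negPf->.
apply/setP => s; rewrite !inE.
apply/and3P/eqP => [[/betweenP Ts /eqP sp /forallP sW]|->].
  have sT : edge_set s = T by apply/setP => e; rewrite Ts ?inE.
  apply: state_ext => // q; rewrite lab_mk // /l0; case: ifP => [qW|/negbT qW].
    exact/eqP/(implyP (sW q)).
  by rewrite -sp; apply: lab_invariant; rewrite sT; apply: (all_liveP _ _ gT).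
split; first exact: between_refl.
  by rewrite lab_mk ?l0p.
by apply/forallP => q; apply/implyP => qW; rewrite lab_mk // /l0 qW.
Qed.

Lemma between_live T D A e B : e \in D -> between T D A ->
    (e \in A) != (e \in T) ->
  between T D B = between T (D :\ e) B || between A (D :\ e) B.
Proof.
move=> eD /betweenP TA eA; rewrite -{1}(setD1K eD) between_addD; congr (_ || _).
apply: between_base; apply/betweenP => f; rewrite !inE negb_and negbK in_toggle.
have [-> _|fe /= fD] := eqVneq f e; last by rewrite TA.
by move: eA; case: (e \in A); case: (e \in T).
Qed.

Lemma collapses_live T D W l A e m n : e \in D -> between T D A ->
    e \in A -> e \notin T ->
    states_collapse (block p T (D :\ e) W l) m ->
    states_collapse (block p A (D :\ e) W l) n ->
  states_collapse (block p T D W l) (m + n).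
Proof.
move=> eD TA eA eT colT colA.
have eAT : (e \in A) != (e \in T) by rewrite eA (negPf eT).
have -> : block p T D W l = block p T (D :\ e) W l :|: block p A (D :\ e) W l.
  by apply/setP => s; rewrite !inE (between_live _ eD TA eAT) andb_orl.
have supe B s : s \in block p B (D :\ e) W l -> (e \in edge_set s) = (e \in B).
  by rewrite inE => /and3P[/betweenP-> //]; rewrite !inE eqxx.
apply: collapses_union => //.
- rewrite -setI_eq0; apply/eqP/setP => s; rewrite in_set0.
  by apply/negP => /setIP[/supe sT /supe]; rewrite sT eA (negPf eT).
- move=> s t /supe sA /supe tT; apply/eqP.
  apply: contraTT eT => /state_coef_neq0[f [_ ts _]].
  by rewrite -tT ts inE sA eA orbT.
- by move=> s t /state_coef_bideg/eqP.
Qed.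

Lemma card_live_trees T D W A e : e \in D -> between T D A ->
    (e \in A) != (e \in T) ->
  #|live_trees T D W| = (#|live_trees T (D :\ e) W| + #|live_trees A (D :\ e) W|)%N.
Proof.
move=> eD TA eA.
have -> : live_trees T D W = live_trees T (D :\ e) W :|: live_trees A (D :\ e) W.
  by apply/setP => B; rewrite !inE (between_live _ eD TA eA) andb_orl.
rewrite cardsU disjoint_setI0 ?cards0 ?subn0 // -setI_eq0.
apply/eqP/setP => B; rewrite in_set0; apply/negP => /setIP[]; rewrite !inE.
move=> /andP[/betweenP TB _] /andP[/betweenP AB _].
by move: eA; rewrite -TB -?AB ?eqxx // !inE eqxx.
Qed.

(** With no edge left, a block has one state. An edge on which two quasi-trees
    differ cuts the block in two, each half containing a quasi-tree. Otherwise
    [leaf_peel] applies. *)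
Lemma collapses_block T D W l : dead p T D W -> all_live W T ->
    (forall q r, q \in W -> same T q r -> l q = l r) ->
  states_collapse (block p T D W l) #|live_trees T D W|.
Proof.
elim: {D}#|D| {-2}D (erefl #|D|) T W l => [|n IH] D cD T W l dW gT lW.
  move/eqP: cD; rewrite cards_eq0 => /eqP D0; rewrite {D}D0 in dW *.
  have -> : live_trees T set0 W = [set T].
    apply/setP => A; rewrite !inE; apply/andP/eqP => [[/betweenP TA _]|->].
      by apply/setP => e; rewrite TA ?inE.
    by split=> //; apply: between_refl.
  rewrite block_set0 // cards1; set s0 := mk_state T _.
  by have := collapses_all (@state_bideg G) (@state_coef G) [set s0]; rewrite cards1.
have cD' e : e \in D -> #|D :\ e| = n.
  by move=> eD; move: cD; rewrite (cardsD1 e) eD => -[].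
have [/existsP[e /andP[eD /existsP[A /and3P[TA gA eA]]]]|nlive] :=
    boolP [exists e, (e \in D) && [exists A,
      [&& between T D A, all_live W A & (e \in A) != (e \in T)]]].
  have dead' B : between T D B -> dead p B (D :\ e) W.
    move=> TB; have [pW WW WD] := dead_base dW TB.
    by split=> // f /setD1P[_ /WD].
  have colT := IH _ (cD' e eD) _ _ _ (dead' _ (between_refl T D)) gT lW.
  have lA q r : q \in W -> same A q r -> l q = l r.
    by move=> qW; rewrite (dead_same _ dW TA) //; apply: lW.
  have colA := IH _ (cD' e eD) _ _ _ (dead' _ TA) gA lA.
  rewrite (card_live_trees _ eD TA eA).
  have [eT|eT] := boolP (e \in T); last first.
    apply: (collapses_live eD TA _ eT colT colA).
    by move: eA; rewrite (negPf eT); case: (e \in A).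
  have AT : between A D T by rewrite -(between_base TA) between_refl.
  have -> : block p T D W l = block p A D W l.
    by apply/setP => s; rewrite !inE (between_base TA).
  rewrite addnC; apply: (collapses_live eD AT eT _ colA colT).
  by move: eA; rewrite eT; case: (e \in A).
have uniqT A : between T D A -> all_live W A -> A = T.
  move=> TA gA; apply/setP => e.
  have [eD|/(elimT (betweenP _ _ _) TA)//] := boolP (e \in D).
  apply/eqP; apply: contraR nlive => eA; apply/existsP; exists e; rewrite eD.
  by apply/existsP; exists A; rewrite TA gA.
have [|e [W' [l' [[eD dW' gB] lW' tB]]]] := leaf_peel dW gT uniqT _ lW.
  by rewrite -card_gt0 cD.
have -> : #|live_trees T D W| = 1%N.
  rewrite -(cards1 T); congr #|pred_of_set _|; apply/setP => A; rewrite !inE.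
  by apply/andP/eqP => [[]|->]; [exact: uniqT | rewrite between_refl].
by apply; have := IH _ (cD' e eD) _ _ _ dW' gB lW'; rewrite tB cards1.
Qed.

End Induction.

(** * Existence of a quasi-tree *)

Section QuasiTrees.

Variable G : ribbon_graph.
Implicit Types (A : {set edge G}) (e : edge G) (h k : hedge G) (q r : bdarc G).

Section AllSplit.

Variable A : {set edge G}.
Hypothesis allS : forall e, splits A e.

(** Together with [same_vrot]: if every edge has both feet on one component,
    components are unions of whole vertex circles, and adjacent vertices share
    theirs. *)
Lemma same_flip h : same A (inl (flip h)) (inl h).
Proof. by case: h => e []; [|rewrite same_sym]; exact: (allS e). Qed.

Lemma same_vrot h : same A (inl (vrot G h)) (inl h).
Proof.
have [hA|hA] := boolP (h.1 \in A).
  apply: same_trans (same_flip h).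
  have -> : inl (vrot G h) = walk A (inl (flip h)); last exact: same_walk.
  by rewrite permE /= hA /flip /= negbK; case: h hA.
have -> : inl (vrot G h) = walk A (inl h); last exact: same_walk.
by rewrite permE /= (negPf hA).
Qed.

Lemma same_vertex h k : hvert h = hvert k -> same A (inl k) (inl h).
Proof.
move/eqP; rewrite hvert_vrot => /porbitP[i ->].
elim: i => [|i IH]; first by rewrite expg0 perm1 same_refl.
by rewrite expgSr permM; apply: same_trans IH; apply: same_vrot.
Qed.

Lemma same_connect h u : connect (@adjacent G) (hvert h) u ->
  forall k, hvert k = u -> same A (inl k) (inl h).
Proof.
move/connectP => [s ps ->]; elim/last_ind: s ps => [|s v IH] /=.
  by move=> _ k kh; apply: same_vertex.
rewrite rcons_path last_rcons => /andP[/IH hs].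
move=> /existsP[k /andP[/eqP ks /eqP kv]] k' k'v.
apply: same_trans (hs _ ks); apply: same_trans (same_flip k).
by apply: same_vertex; rewrite k'v.
Qed.

Lemma connect_isolated (v w : vertex G) :
  isolated v -> connect (@adjacent G) v w -> v = w.
Proof.
move/forallP => iv /connectP[[|x s] /=]; first by [].
by move/andP => [/existsP[k /andP[kv]]]; rewrite (negPf (iv k)) in kv.
Qed.

Lemma same_all : connected G -> forall q r, same A q r.
Proof.
move=> conn [h|[v iv]] [k|[w iw]].
- exact: (same_connect (conn (hvert k) (hvert h))).
- have wh := connect_isolated iw (conn w (hvert h)).
  by case/eqP: (elimT forallP iw h); rewrite wh.
- have wh := connect_isolated iv (conn v (hvert k)).
  by case/eqP: (elimT forallP iv k); rewrite wh.
- have vw := connect_isolated iv (conn v w); subst w.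
  by rewrite (bool_irrelevance iv iw) same_refl.
Qed.

End AllSplit.

(** If the feet of some edge were on distinct components, toggling it would
    merge them, contradicting minimality. *)
Lemma connected_one_boundary : connected G ->
  exists A, forall q r, same A q r.
Proof.
move=> conn.
have [A _ Amin] := arg_minnP (fun A => #|porbits (walk A)|) (erefl : xpredT set0).
exists A; apply: same_all => // e; apply/negPn/negP => nS.
have := card_porbits_toggle A e; have := Amin (toggle e A) isT; rewrite nS; lia.
Qed.

Lemma card_bcomp1 A (p : bdarc G) : (#|{: bcomp A}| == 1%N) = all_live p set0 A.
Proof.
rewrite card_sig; apply/cards1P/all_liveP => [[c cE] q _|h].
  have cq r : porbit (walk A) r = c.
    by apply/set1P; rewrite -cE mem_porbits.
  by rewrite /same !cq.
exists (porbit (walk A) p); apply/setP => c; rewrite !inE.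
apply/imsetP/eqP => [[q _ ->]|->].
  by apply/eqP/h; rewrite inE.
by exists p.
Qed.

End QuasiTrees.

(** * The reduced complex *)

Section Reduced.

Variables (G : ribbon_graph) (p : bdarc G).

Lemma marked_minusE (s : state G) : marked_minus p s = (lab s p == vminus).
Proof. by case: s. Qed.

(** A path from a marked state to a marked state passes through marked states
    only, so the sum over the intermediate states may be extended to all of
    them. *)
Lemma rCKh_complex : is_cochain_complex (rCKh p).
Proof.
split=> [s t /= /state_coef_bideg -> //|f].
apply/ffunP => u; rewrite !ffunE; under eq_bigr do rewrite ffunE mulr_suml.
rewrite exchange_big big1 //= => s _.
under eq_bigr do rewrite -mulrA; rewrite -mulr_sumr.
rewrite -[RHS](mulr0 (f s)); congr (_ * _).
rewrite -[RHS](state_coef_square (val s) (val u)).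
rewrite -(big_val (P := marked_minus p)) //= => t.
rewrite marked_minusE => tm; apply/eqP; rewrite mulf_eq0; apply/orP; left.
apply: contraR tm => /state_coef_neq0[e [es ts n0]].
have n1 : edge_coef e (val s) t != 0 by rewrite /edge_coef es ts eqxx.
by apply/eqP/(edge_coef_minus n1)/eqP; rewrite -marked_minusE (valP s).
Qed.

End Reduced.

Lemma card_bijective (S T : finType) : #|S| = #|T| -> exists f : S -> T, bijective f.
Proof.
move=> ST; exists (fun x => enum_val (cast_ord ST (enum_rank x))).
exists (fun y => enum_val (cast_ord (esym ST) (enum_rank y))) => x;
by rewrite enum_valK ?cast_ordK ?cast_ordKV enum_rankK.
Qed.

Theorem theorem1p2 (G : ribbon_graph) (p : bdarc G) :
  connected G ->
  exists C : bgroup,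
    [/\ is_cochain_complex C,
        exists f : gen C -> quasi_tree G, bijective f
      & same_homology C (rCKh p)].
Proof.
move=> conn; have [T sameT] := connected_one_boundary conn.
have deadT : dead p T [set: edge G] set0.
  by split=> [|q|e _ b]; rewrite ?inE.
have liveT : all_live p set0 T by apply/all_liveP.
have coll : states_collapse
    [set s | marked_minus p s] #|live_trees p T [set: edge G] set0|.
  have -> : [set s | marked_minus p s] = block p T [set: edge G] set0 (fun=> vminus).
    apply/setP => s; rewrite !inE marked_minusE.
    rewrite (introT (betweenP _ _ _)) => [|e]; last by rewrite inE.
    by rewrite (introT forallP) ?andbT // => q; rewrite inE.
  by apply: collapses_block.
have [|C [Ccomplex cardC homC]] := @collapses_homology _
    #|live_trees p T [set: edge G] set0| (rCKh_complex p).
  by apply: collapses_sub coll => s t; rewrite /raises /= !xpair_eqE (inj_eq (addIr _)).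
exists C; split=> //; apply: card_bijective; rewrite cardC card_sig.
apply: eq_card => A; rewrite !inE (card_bcomp1 A p).
by rewrite (introT (betweenP _ _ _)) // => e; rewrite inE.
Qed.
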